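(* Let $(F|K,v)$ be a valued function field such that $v$ is trivial on $K$. Assume that there exists a transcendence basis $T$ of $F|K$ such that $(K(T)|K,v)$ admits local uniformization and $F\subseteq K(T)^i$. Then $(F|K,v)$ admits local uniformization.
   Context: A valued function field $(F|K,v)$ is an algebraic function field $F|K$ (a finitely generated field extension) together with a (Krull) valuation $v$ on $F$. For a subfield $E\subseteq F$, $\mathcal O_E=\mathcal O_v\cap E$ and $\mathfrak m_E=\mathfrak m_v\cap E$, and $E$ carries the restriction of $v$. For $L=K(T)$, $L^i=K(T)^i$ denotes the absolute inertia field of $L$ with respect to some extension of $v$ from $F$ to the separable-algebraic closure: with $v$ also denoting this extension to $L^{\mathrm{sep}}$, $\mathfrak m_v$ its maximal ideal, and $I(\mathcal O_L)$ the integral closure of $\mathcal O_L$ in $L^{\mathrm{sep}}$, $L^i$ is the subfield of $L^{\mathrm{sep}}$ of elements fixed by $\{\sigma\in\mathrm{Gal}(L^{\mathrm{sep}}|L)\mid \forall x\in I(\mathcal O_L):\ x-\sigma(x)\in\mathfrak m_v\cap I(\mathcal O_L)\}$. For $v$ trivial on $K$, an affine model of $(F|K,v)$ on which $v$ has a center is $V=\mathrm{Spec}(R)$ with $R\subseteq\mathcal O_F$ a finitely generated $K$-algebra whose quotient field is $F$; the center of $v$ on $V$ is the prime $\mathfrak p=R\cap\mathfrak m_F$, and $\mathcal O_{V,\mathfrak p}=R_{\mathfrak p}$. $(F|K,v)$ admits local uniformization if for every finite set $Z\subseteq\mathcal O_F$ there exists an affine model $V$ of $(F|K,v)$ such that the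 center $\mathfrak p$ of $v$ on $V$ is a regular point (i.e. $\mathcal O_{V,\mathfrak p}$ is a regular local ring) and $Z\subseteq\mathcal O_{V,\mathfrak p}$. The same definition applies to $(K(T)|K,v)$. *)

(* Defs.v *)
From mathcomp Require Import all_boot all_order all_algebra separable.
From mathcomp Require Import boolp classical_sets cardinality.
(* The notations of mpoly clash with those of classical_sets. *)
From mathcomp Require Import -(notations) mpoly.

Set Implicit Arguments.
Unset Strict Implicit.
Unset Printing Implicit Defensive.

Import Order.TTheory GRing.Theory Num.Theory.

Local Open Scope classical_set_scope.
Local Open Scope ring_scope.

(* [porderZmodType] puts no compatibility condition between order and
   addition; it is added here, together with totality of the order. *)
Record ordered_group := OrderedGroup {
  ordered_group_sort :> porderZmodType;
  ordered_group_total : total (<=%R : rel ordered_group_sort);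
  ordered_group_leD2l : forall z x y : ordered_group_sort,
    x <= y -> z + x <= z + y
}.

(* A Krull valuation, as a homomorphism from the multiplicative group of [F] to
   an ordered abelian group. The convention v(0) = oo is implemented by
   ignoring the value of the function at 0. *)
Record valuation (F : fieldType) := Valuation {
  value_group : ordered_group;
  val_fun :> F -> value_group;
  valM : forall x y, x != 0 -> y != 0 -> val_fun (x * y) = val_fun x + val_fun y;
  valD : forall x y, x != 0 -> y != 0 -> x + y != 0 ->
    Num.min (val_fun x) (val_fun y) <= val_fun (x + y)
}.

Section Valuations.
Variables (F : fieldType) (v : valuation F).

Definition valuation_ring : set F := [set x | x = 0 \/ 0 <= v x].

Definition valuation_ideal : set F := [set x | x = 0 \/ 0 < v x].

Definition trivial_on (K : set F) : Prop := forall x, K x -> x != 0 -> v x = 0.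

End Valuations.

(* Valuations are compared up to equivalence: [w] extends [v] when the
   valuation ring of [w] lies over that of [v]. *)
Definition extends (F S : fieldType) (iota : {rmorphism F -> S})
    (v : valuation F) (w : valuation S) : Prop :=
  iota @^-1` valuation_ring w = valuation_ring v.

(* Subfields, subrings and their ideals are all represented as subsets of an
   ambient field. *)
Section Subsets.
Variable F : fieldType.
Implicit Types (K E L A I P R T Z : set F) (v : valuation F).

Definition subfield E : Prop := GRing.divring_closed [in E].

Definition subring A : Prop := GRing.subring_closed [in A].

Definition adjoin_field K T : set F := smallest subfield (K `|` T).

Definition adjoin_ring K T : set F := smallest subring (K `|` T).

Definition function_field K : Prop :=
  exists s : seq F, adjoin_field K [set` s] = setT.

Definition algebraic_over E (x : F) : Prop :=
  exists p : {poly F}, [/\ p \is a polyOver [in E], p != 0 & root p x].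

Definition separable_over E (x : F) : Prop :=
  exists p : {poly F}, [/\ p \is a polyOver [in E], separable_poly p & root p x].

Definition integral_over A (x : F) : Prop :=
  exists p : {poly F}, [/\ p \is a polyOver [in A], p \is monic & root p x].

Definition algebraically_independent K T : Prop :=
  forall (n : nat) (t : 'I_n -> F), injective t -> (forall i, T (t i)) ->
  forall p : mpoly n F, p \is a mpolyOver n [in K] ->
    meval t p = 0 -> p = 0.

Definition transcendence_basis K T : Prop :=
  algebraically_independent K T /\ forall x, algebraic_over (adjoin_field K T) x.

Definition ideal A I : Prop :=
  [/\ I `<=` A, I 0, forall x y, I x -> I y -> I (x + y)
    & forall a x, A a -> I x -> I (a * x)].

Definition proper_ideal A I : Prop := ideal A I /\ ~ I 1.

Definition prime_ideal A P : Prop :=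
  proper_ideal A P /\
  forall x y, A x -> A y -> P (x * y) -> P x \/ P y.

Definition maximal_ideal A I : Prop :=
  proper_ideal A I /\ forall J, proper_ideal A J -> I `<=` J -> J = I.

Definition ideal_gen A (s : seq F) : set F := smallest (ideal A) [set` s].

Definition noetherian A : Prop :=
  forall I, ideal A I -> exists s : seq F, I = ideal_gen A s.

(* Q 0 < Q 1 < ... < Q n; the values of [Q] beyond [n] are irrelevant. *)
Definition prime_chain A (n : nat) (Q : nat -> set F) : Prop :=
  (forall i, (i <= n)%N -> prime_ideal A (Q i)) /\
  (forall i, (i < n)%N -> Q i `<` Q i.+1).

Definition has_krull_dim A (d : nat) : Prop :=
  (exists Q, prime_chain A d Q) /\
  forall n Q, prime_chain A n Q -> (n <= d)%N.

Definition local_ring A (m : set F) : Prop :=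
  forall I, maximal_ideal A I <-> I = m.

Definition regular_local_ring A : Prop :=
  [/\ subring A, noetherian A &
    exists m, local_ring A m /\
    exists d, has_krull_dim A d /\
    exists2 s : seq F, size s = d & m = ideal_gen A s].

Definition localization R P : set F :=
  [set x | exists a b, [/\ R a, R b, ~ P b & x = a / b]].

Definition fraction_field R : set F := localization R [set 0].

(* The finitely generated algebra [R] stands for Spec R; being contained in the
   valuation ring means that [v] has a center on it. *)
Definition affine_model K E v R : Prop :=
  [/\ exists s : seq F, R = adjoin_ring K [set` s],
      R `<=` valuation_ring v `&` E & fraction_field R = E].

Definition center v R : set F := R `&` valuation_ideal v.

(* Local uniformization of (E|K, v), where K and E are subfields of F and E
   carries the restriction of v. *)
Definition local_uniformization K E v : Prop :=
  forall Z, finite_set Z -> Z `<=` valuation_ring v `&` E ->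
  exists R, [/\ affine_model K E v R,
    regular_local_ring (localization R (center v R))
    & Z `<=` localization R (center v R)].

Definition separably_closed : Prop :=
  forall p : {poly F}, separable_poly p -> (1 < size p)%N -> exists x, root p x.

(* The whole field F is a separable-algebraic closure of its subfield L. *)
Definition separable_closure_of L : Prop :=
  (forall x, separable_over L x) /\ separably_closed.

Definition galois_aut L (sigma : {rmorphism F -> F}) : Prop :=
  bijective sigma /\ forall x, L x -> sigma x = x.

(* Absolute inertia field of (L, v), where F is the separable-algebraic closure
   of L and v is a valuation on all of F. *)
Definition absolute_inertia_field L v : set F :=
  let I := integral_over (valuation_ring v `&` L) in
  let inertia (sigma : {rmorphism F -> F}) :=
    galois_aut L sigma /\
    forall x, I x -> (valuation_ideal v `&` I) (x - sigma x) in
  [set x | forall sigma, inertia sigma -> sigma x = x].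

End Subsets.

(* Main.v *)
(** Proof idea.  Write [L = K(T)] and let [O], [M] be the valuation ring and its
    ideal.

    If an embedding of [F] into [Lsep] over [L] is the identity modulo [M] on the
    integral closure of [O ∩ L] in [F], then by Zorn's lemma it extends to an
    element of the inertia group, so it is the identity because [F ⊆ L^i].  Hence
    every other embedding moves some integral element of [F] modulo [M]; a single
    integral [x] can be chosen that is moved by all of them.  The monic
    polynomial [f] with roots the conjugates of [x] then satisfies
    [f'(x) ∉ M].  Lagrange interpolation gives [f'(x) c ∈ (O ∩ L)[x]] for [c]
    integral, so every element of the valuation ring of [F] is a quotient of two
    elements of [(O ∩ L)[x]] with denominator outside [M].

    Choose now a model [R] of [L] with regular center whose local ring [A]
    contains the finitely many coefficients involved.  The local ring [B] of
    [R[x]] at the center is that of [A[x]], a free [A]-module: [B] is noetherian,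
    its maximal ideal is generated by that of [A] as [f'(x) ∉ M], and its
    dimension is that of [A], by incomparability and by going-down. *)

From HB Require Import structures.
Require Import Defs.
From mathcomp Require Import all_boot all_order all_algebra.
From mathcomp Require Import boolp classical_sets cardinality.
From mathcomp Require Import cyclic separable ring.

Set Implicit Arguments.
Unset Strict Implicit.
Unset Printing Implicit Defensive.

Import Order.TTheory GRing.Theory Num.Theory.

Local Open Scope classical_set_scope.
Local Open Scope ring_scope.

(** * Subrings and subfields *)

(** An automorphism of [Lsep] need not preserve the valuation, so comparing [sigma c] with [c]
    modulo [M] makes sense only on the integral closure of [O ∩ L], which is stable under
    conjugation and contained in [O]. Hence the Galois arguments concern integral elements, and a
    separate argument writes every valued element as a fraction of integral ones with denominator
    outside [M].

    The one-step extension fed to Zorn's lemma and the choice of [x] rest on the same separation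
    statement: if each of finitely many embeddings moves some integral element modulo [M], then one
    integral element is moved by all of them. Its proof splits according to whether the base has
    infinitely or finitely many residues.

    Separation also makes the conjugates of [x] distinct, so [f] is its minimal polynomial over [L].
    This is what makes [A[x]] free, and freeness is the source of going-down. *)

Section SubringPredicates.
Variables (F : fieldType) (A : set F).

(** Taking the closure proof as an argument lets the instances below be attached to the predicate,
    so that the [rpred] lemmas apply to plain sets. *)
Definition subring_pred of subring A : {pred F} := [in A].

Definition subfield_pred of subfield A : {pred F} := [in A].

Lemma subring_predE (hA : subring A) x : x \in subring_pred hA <-> A x.
Proof. by rewrite /= inE. Qed.

Lemma subfield_predE (hA : subfield A) x : x \in subfield_pred hA <-> A x.
Proof. by rewrite /= inE. Qed.

End SubringPredicates.

HB.instance Definition _ (F : fieldType) (A : set F) (hA : subring A) :=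
  GRing.isSubringClosed.Build F (subring_pred hA) hA.
HB.instance Definition _ (F : fieldType) (A : set F) (hA : subfield A) :=
  GRing.isDivringClosed.Build F (subfield_pred hA) hA.

Section SubringTypes.
Variables (F : fieldType) (A : set F).

(** A ring type for the subset, so that [integralOver] can be used for integrality. *)
Record subring_type (hA : subring A) :=
  SubringType { subring_val :> F; _ : subring_val \in subring_pred hA }.

HB.instance Definition _ (hA : subring A) := [isSub for @subring_val hA].
HB.instance Definition _ (hA : subring A) := [Choice of subring_type hA by <:].
HB.instance Definition _ (hA : subring A) :=
  [SubChoice_isSubComNzRing of subring_type hA by <:].

End SubringTypes.

Section SubringFacts.
Variables (F : fieldType) (A : set F).

Lemma subringP : subring A <->
  [/\ A 1, forall x y, A x -> A y -> A (x - y) & forall x y, A x -> A y -> A (x * y)].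
Proof.
split=> [[h1 hB hM]|[h1 hB hM]].
  split=> [|x y Ax Ay|x y Ax Ay]; first exact/set_mem.
    by apply/set_mem/hB; exact/mem_set.
  by apply/set_mem/hM; exact/mem_set.
split=> [|x y /set_mem Ax /set_mem Ay|x y /set_mem Ax /set_mem Ay]; apply/mem_set => //.
  exact: hB.
exact: hM.
Qed.

Lemma subfieldP : subfield A <->
  [/\ A 1, forall x y, A x -> A y -> A (x - y) & forall x y, A x -> A y -> A (x / y)].
Proof.
split=> [[h1 hB hM]|[h1 hB hM]].
  split=> [|x y Ax Ay|x y Ax Ay]; first exact/set_mem.
    by apply/set_mem/hB; exact/mem_set.
  by apply/set_mem/hM; exact/mem_set.
split=> [|x y /set_mem Ax /set_mem Ay|x y /set_mem Ax /set_mem Ay]; apply/mem_set => //.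
  exact: hB.
exact: hM.
Qed.

Lemma subfield_subring : subfield A -> subring A.
Proof.
move=> hA; split; first by case: hA.
  by case: hA.
by move=> x y hx hy; have := @rpredM _ (subfield_pred hA) x y hx hy.
Qed.

Hypothesis hA : subring A.

Lemma subring0 : A 0. Proof. exact/(subring_predE hA)/rpred0. Qed.
Lemma subring1 : A 1. Proof. exact/(subring_predE hA)/rpred1. Qed.
Lemma subringD x y : A x -> A y -> A (x + y).
Proof.
by move=> /(subring_predE hA) Ax /(subring_predE hA) Ay; apply/(subring_predE hA)/rpredD.
Qed.
Lemma subringB x y : A x -> A y -> A (x - y).
Proof.
by move=> /(subring_predE hA) Ax /(subring_predE hA) Ay; apply/(subring_predE hA)/rpredB.
Qed.
Lemma subringN x : A x -> A (- x).
Proof. by move=> /(subring_predE hA) Ax; apply/(subring_predE hA); rewrite rpredN. Qed.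
Lemma subringM x y : A x -> A y -> A (x * y).
Proof.
by move=> /(subring_predE hA) Ax /(subring_predE hA) Ay; apply/(subring_predE hA)/rpredM.
Qed.
Lemma subringX x n : A x -> A (x ^+ n).
Proof. by move=> /(subring_predE hA) Ax; apply/(subring_predE hA)/rpredX. Qed.

End SubringFacts.

Lemma subfieldV (F : fieldType) (A : set F) x : subfield A -> A x -> A x^-1.
Proof. by move=> hA /(subfield_predE hA) Ax; apply/(subfield_predE hA); rewrite rpredV. Qed.

Lemma polyOver_subringE (F : fieldType) (A : set F) (hA : subring A) (p : {poly F}) :
  p \is a polyOver [in A] = (p \is a polyOver (subring_pred hA)).
Proof. by []. Qed.

Lemma polyOver_setP (F : fieldType) (A : set F) (p : {poly F}) :
  A 0 -> p \is a polyOver [in A] <-> forall i, A p`_i.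
Proof.
move=> A0; split=> [/allP h i|h]; last by apply/allP => x /(nthP 0) [i _ <-]; exact/mem_set.
case: (ltnP i (size p)) => hi; last by rewrite nth_default.
by apply/set_mem/h/mem_nth.
Qed.

(** The gcd of [p] and [h] vanishes at [y], so it is not constant and is associate to [p]: up to a
    scalar, [p] is the minimal polynomial of [y]. *)
Lemma irreducible_root (E S : fieldType) (tau : {rmorphism E -> S}) (p h : {poly E}) y :
  irreducible_poly p -> root (map_poly tau p) y ->
  root (map_poly tau h) y = (p %| h).
Proof.
move=> irr_p py; apply/idP/idP => [hy|/dvdpP [q ->]]; last first.
  by rewrite rmorphM rootM py orbT.
have dy : root (map_poly tau (gcdp p h)) y by rewrite gcdp_map root_gcd py.
have : size (gcdp p h) != 1%N.
  apply/eqP => d1; have d0 : map_poly tau (gcdp p h) != 0.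
    by rewrite map_poly_eq0 -size_poly_eq0 d1.
  by have := root_size_gt1 d0 dy; rewrite size_map_poly d1.
by move=> d1; have /andP[_] := irr_p _ d1 (dvdp_gcdl _ _); rewrite dvdp_gcd => /andP [].
Qed.

(** A nonzero polynomial of least degree vanishing at [y] is irreducible, since one of two proper
    factors would vanish at [y] as well. *)
Lemma exists_irreducible_root (E S : fieldType) (i : {rmorphism E -> S}) (q : {poly E}) y :
  q != 0 -> root (map_poly i q) y ->
  exists2 p, irreducible_poly p & root (map_poly i p) y.
Proof.
elim: {q}(size q) {-2}q (leqnn (size q)) => [q|n IHn q sq q0 qy].
  by rewrite leqn0 size_poly_eq0 => /eqP->; rewrite eqxx.
have [|red] :=
  pselect (exists r : {poly E}, [/\ r != 0, (size r < size q)%N & root (map_poly i r) y]).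
  by move=> [r [r0 srq ry]]; apply: (IHn r) => //; rewrite -ltnS (leq_trans srq).
exists q => //; split.
  have := q0; rewrite -(map_poly_eq0 i) => /root_size_gt1 /(_ qy).
  by rewrite size_map_poly.
move=> d d1 /dvdpP [r defq]; have [r0 d0] : r != 0 /\ d != 0.
  by apply/andP; rewrite -negb_or -mulf_eq0 -defq.
have := qy; rewrite defq rmorphM rootM => /orP [ry|dy].
  case: red; exists r; split => //.
  rewrite defq size_mul // (polySpred d0).
  case: (size d) d1 (size_poly_eq0 d) => [|[|m]] //; rewrite ?(negPf d0) //= => _ _.
  by rewrite addnS /= addnS ltnS leq_addr.
rewrite -dvdp_size_eqp ?dvdp_mull // eqn_leq.
apply/andP; split; first by rewrite size_mul // (polySpred r0) addSn leq_addl.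
by rewrite leqNgt; apply/negP => lt_dq; apply: red; exists d; rewrite defq.
Qed.

(** * Isomorphisms between subfields *)

Section FieldGraphs.
Variable S : fieldType.
Implicit Types (g : set (S * S)).

(* The graph of an isomorphism between two subfields of [S], as a subring of the
   ring [S * S]. *)
Definition field_graph g : Prop :=
  GRing.divring_closed [in g] /\ forall q, g q -> (q.1 == 0) = (q.2 == 0).

Definition graph_pred g of field_graph g : {pred S * S} := [in g].

Lemma graph_predE g (hg : field_graph g) q : q \in graph_pred hg <-> g q.
Proof. by rewrite /= inE. Qed.

(** In the product ring a non-unit is its own inverse by convention, so inversion is componentwise
    only if the components vanish together. *)
Lemma pair_invE (a b : S) : (a == 0) = (b == 0) -> (a, b)^-1 = (a^-1, b^-1).
Proof.
have -> : (a, b)^-1 = if (a \is a GRing.unit) && (b \is a GRing.unit)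
  then (a^-1, b^-1) else (a, b) by [].
rewrite !unitfE; have [->|a0] := eqVneq a 0; have [->|b0] := eqVneq b 0 => //= _.
by rewrite !invr0.
Qed.

Lemma field_graphP g : g (1, 1) ->
  (forall a b c d, g (a, b) -> g (c, d) -> g (a - c, b - d)) ->
  (forall a b c d, g (a, b) -> g (c, d) -> g (a / c, b / d)) ->
  (forall a b, g (a, b) -> (a == 0) = (b == 0)) -> field_graph g.
Proof.
move=> g1 gB gD g0; split; last by case=> a b /g0.
split=> [|[a b] [c d] /set_mem ab /set_mem cd|[a b] [c d] /set_mem ab /set_mem cd].
- exact/mem_set.
- exact/mem_set/gB.
- by apply/mem_set; rewrite pair_invE; [exact: gD|exact: g0].
Qed.

End FieldGraphs.

HB.instance Definition _ (S : fieldType) (g : set (S * S)) (hg : field_graph g) :=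
  GRing.isDivringClosed.Build (S * S)%type (graph_pred hg) (proj1 hg).

Section GraphType.
Variables (S : fieldType) (g : set (S * S)).

(** A partial isomorphism becomes a field with two embeddings into [S]. A polynomial over it has two
    images, the second being the transport of the first by the isomorphism. *)
Record graph_type (hg : field_graph g) :=
  GraphType { graph_val :> S * S; _ : graph_val \in graph_pred hg }.

HB.instance Definition _ (hg : field_graph g) := [isSub for @graph_val hg].
HB.instance Definition _ (hg : field_graph g) := [Choice of graph_type hg by <:].
HB.instance Definition _ (hg : field_graph g) :=
  [SubChoice_isSubComUnitRing of graph_type hg by <:].

Variable hg : field_graph g.

Lemma graph_type_field : GRing.field_axiom (graph_type hg).
Proof.
case=> -[a b] ab x0; have [/= eq_ab a0] : (a == 0) = (b == 0) /\ a != 0.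
  have /= eq_ab := hg.2 _ (iffLR (graph_predE hg _) ab); split => //.
  by apply: contra x0 => a0; rewrite -val_eqE /= xpair_eqE -eq_ab a0.
apply/unitrP; pose c : S * S := (a, b)^-1.
have cP : c \in graph_pred hg by rewrite rpredV.
exists (GraphType cP); split; apply: val_inj; rewrite /= /c pair_invE //;
  by congr (_, _); rewrite /= ?mulVf ?mulfV // -eq_ab.
Qed.

HB.instance Definition _ := GRing.ComUnitRing_isField.Build (graph_type hg)
  graph_type_field.

Definition graph_fst (q : graph_type hg) : S := (val q).1.
Definition graph_snd (q : graph_type hg) : S := (val q).2.
HB.instance Definition _ := GRing.RMorphism.copy graph_fst (fst \o val).
HB.instance Definition _ := GRing.RMorphism.copy graph_snd (snd \o val).

End GraphType.

Lemma rmorphism_of_fun (R S : fieldType) (f : R -> S) :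
  f 1 = 1 -> {morph f : x y / x - y} -> {morph f : x y / x * y} ->
  exists sigma : {rmorphism R -> S}, sigma =1 f.
Proof.
move=> f1 fB fM.
pose fZ := GRing.isZmodMorphism.Build R S f fB.
pose fR := GRing.isMonoidMorphism.Build R S f (conj f1 fM).
pose sigma : {rmorphism R -> S} := HB.pack f fZ fR.
by exists sigma.
Qed.

Section GraphExtension.
Variables (S : fieldType).
Implicit Types g : set (S * S).

Section GraphTheory.
Variables (g : set (S * S)) (hg : field_graph g).

Lemma graph1 : g (1, 1).
Proof. exact/(graph_predE hg)/rpred1. Qed.

Lemma graphB a b c d : g (a, b) -> g (c, d) -> g (a - c, b - d).
Proof.
move=> /(graph_predE hg) ab /(graph_predE hg) cd.
exact/(graph_predE hg)/(rpredB ab cd).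
Qed.

Lemma graphM a b c d : g (a, b) -> g (c, d) -> g (a * c, b * d).
Proof.
move=> /(graph_predE hg) ab /(graph_predE hg) cd.
exact/(graph_predE hg)/(rpredM ab cd).
Qed.

Lemma graph_div a b c d : g (a, b) -> g (c, d) -> g (a / c, b / d).
Proof.
move=> ab cd; rewrite -[(_, _)]/((a, b) * (c^-1, d^-1)).
have /= cd0 := hg.2 _ cd.
move/(graph_predE hg): ab => ab; move/(graph_predE hg): cd => cd.
by apply/(graph_predE hg); rewrite -pair_invE // rpredM ?rpredV.
Qed.

Lemma graph_eq0 a b : g (a, b) -> (a == 0) = (b == 0).
Proof. exact: hg.2. Qed.

Lemma graph_fun a b c : g (a, b) -> g (a, c) -> b = c.
Proof.
by move=> ab ac; apply/eqP; rewrite -subr_eq0 -(graph_eq0 (graphB ab ac)) subrr.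
Qed.

End GraphTheory.

(** The values of [h] at [y] and at [y'] vanish together, both being equivalent to [p %| h]. The
    graph consists of the pairs of quotients of such values. *)
Lemma morphism_pair_extend (E : fieldType) (i i' : {rmorphism E -> S}) (p : {poly E}) y y' :
  irreducible_poly p -> root (map_poly i p) y -> root (map_poly i' p) y' ->
  exists g, [/\ field_graph g, forall e, g (i e, i' e) & g (y, y')].
Proof.
move=> irr_p py py'.
pose ev h : S := (map_poly i h).[y]; pose ev' h : S := (map_poly i' h).[y'].
have ev0 h : (ev h == 0) = (ev' h == 0).
  by rewrite -!rootE (irreducible_root _ irr_p py) (irreducible_root _ irr_p py').
have evB h k : ev (h - k) = ev h - ev k by rewrite /ev rmorphB hornerD hornerN.
have evM h k : ev (h * k) = ev h * ev k by rewrite /ev rmorphM hornerM.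
have evB' h k : ev' (h - k) = ev' h - ev' k by rewrite /ev' rmorphB hornerD hornerN.
have evM' h k : ev' (h * k) = ev' h * ev' k by rewrite /ev' rmorphM hornerM.
have evC e : ev e%:P = i e by rewrite /ev map_polyC hornerC.
have evC' e : ev' e%:P = i' e by rewrite /ev' map_polyC hornerC.
have evX : ev 'X = y by rewrite /ev map_polyX hornerX.
have evX' : ev' 'X = y' by rewrite /ev' map_polyX hornerX.
have ev1 : ev 1 = 1 by rewrite evC rmorph1.
have ev1' : ev' 1 = 1 by rewrite evC' rmorph1.
clearbody ev ev'.
pose g := [set q | exists h k, [/\ ev k != 0 & q = (ev h / ev k, ev' h / ev' k)]].
have gE h : g (ev h, ev' h) by exists h, 1; rewrite ev1 ev1' !divr1 oner_eq0.
exists g; split; last 2 first.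
- by move=> e; rewrite -evC -evC'.
- by rewrite -evX -evX'.
apply: field_graphP => [|a b c d|a b c d|a b].
- by have := gE 1; rewrite ev1 ev1'.
- move=> [h [k [k0 [-> ->]]]] [h' [k' [k'0 [-> ->]]]].
  exists (h * k' - h' * k), (k * k'); rewrite evM mulf_neq0 //; split=> //.
  rewrite !evM' evB !evM evB' !evM'.
  by congr (_, _); rewrite -mulNr addf_div ?mulNr // -ev0.
- move=> [h [k [k0 [-> ->]]]] [h' [k' [k'0 [-> ->]]]].
  (* Division by zero gives zero, so closure under division also asks for the pair [(0, 0)]. *)
  have [h'0|h'0] := eqVneq (ev h') 0.
    have -> : ev' h' = 0 by apply/eqP; rewrite -ev0 h'0.
    have := gE 0; rewrite -(subrr 1) evB evB' ev1 ev1' !subrr.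
    by rewrite h'0 !mul0r !invr0 !mulr0.
  exists (h * k'), (k * h'); rewrite evM mulf_neq0 //; split=> //.
  by rewrite !evM !evM'; congr (_, _); rewrite invf_div mulf_div.
- by move=> [h [k [k0 [-> ->]]]]; rewrite !mulf_eq0 !invr_eq0 -!ev0.
Qed.

Lemma graph_extend1 g (hg : field_graph g) (p : {poly graph_type hg}) y y' :
  irreducible_poly p -> root (map_poly (@graph_fst _ _ hg) p) y ->
  root (map_poly (@graph_snd _ _ hg) p) y' ->
  exists g', [/\ field_graph g', g `<=` g' & g' (y, y')].
Proof.
move=> irr_p py py'; have [g' [hg' g'P g'y]] := morphism_pair_extend irr_p py py'.
exists g'; split=> // -[a b] gab; have /(graph_predE hg) ab := gab.
exact: (g'P (GraphType ab)).
Qed.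

(* The graphs with property [Phi] are closed under unions of chains, so one that
   can always be enlarged at a prescribed point yields a total map. *)
Lemma graph_extend_total (Phi g0 : set (S * S)) : field_graph g0 -> g0 `<=` Phi ->
  (forall g y, field_graph g -> g0 `<=` g -> g `<=` Phi ->
     exists g', [/\ field_graph g', g `<=` g', g' `<=` Phi & exists y', g' (y, y')]) ->
  exists sigma : {rmorphism S -> S},
    (forall x y, g0 (x, y) -> sigma x = y) /\ forall x, Phi (x, sigma x).
Proof.
move=> hg0 g0Phi step.
pose P g := g = set0 \/ [/\ field_graph g, g0 `<=` g & g `<=` Phi].
have [F FP Ftot|A [PA maxA]] := @Zorn_bigcup _ P.
  have [Fe|/existsNP [X /not_implyP [FX X0]]] := pselect (forall X, F X -> X = set0).
    by left; apply/seteqP; split=> // q [X /Fe ->].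
  have join q q' : (\bigcup_(X in F) X) q -> (\bigcup_(X in F) X) q' ->
      exists X, [/\ F X, field_graph X, X q & X q'].
    move=> [Y FY Yq] [Z FZ Zq'].
    have FG W w : F W -> W w -> field_graph W.
      by move=> /FP [-> //|[]].
    have [YZ|ZY] := Ftot _ _ FY FZ.
      by exists Z; split=> //; [exact: (FG _ q')|exact: YZ].
    by exists Y; split=> //; [exact: (FG _ q)|exact: ZY].
  have [//|[hX g0X _]] := FP _ FX.
  right; split.
  - apply: field_graphP => [|a b c d|a b c d|a b].
    + by exists X => //; exact: graph1.
    + by move=> /join /[apply] -[Y [FY hY Y1 Y2]]; exists Y => //; exact: graphB.
    + by move=> /join /[apply] -[Y [FY hY Y1 Y2]]; exists Y => //; exact: graph_div.
    + by move=> ab; have [Y [_ hY Y1 _]] := join _ _ ab ab; exact: (graph_eq0 hY).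
  - by move=> q /g0X Xq; exists X.
  - by move=> q [Y /FP [-> //|[_ _ YPhi]] /YPhi].
have [hA g0A APhi] : [/\ field_graph A, g0 `<=` A & A `<=` Phi].
  case: PA => [A0|//]; exfalso; apply: (maxA g0); last by right; split.
  by rewrite A0; split=> //; move/(_ _ (graph1 hg0)).
have Atot y : exists y', A (y, y').
  have [g' [hg' Ag' g'Phi [y' g'y]]] := step _ y hA g0A APhi.
  exists y'; apply: contrapT => nA; apply: (maxA g').
    by split=> // /(_ _ g'y).
  by right; split=> //; exact: (subset_trans g0A Ag').
have [f fP] := choice Atot.
have fE x y : A (x, y) -> f x = y.
  exact: (graph_fun hA (fP x)).
have [|x y|x y|sigma sE] := @rmorphism_of_fun _ _ f.
- exact/fE/(graph1 hA).
- exact/fE/(graphB hA).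
- exact/fE/(graphM hA).
exists sigma; split=> [x y /g0A /fE <-|x]; rewrite sE //.
exact/APhi.
Qed.

End GraphExtension.

(** * Separable closures *)

Lemma seq_roots (F : fieldType) (p : {poly F}) :
  p != 0 -> exists rs : seq F, forall x, (x \in rs) = root p x.
Proof.
elim: {p}(size p) {-2}p (leqnn (size p)) => [p|n IHn p sp p0].
  by rewrite leqn0 size_poly_eq0 => /eqP->; rewrite eqxx.
have [[x px]|nr] := pselect (exists x, root p x); last first.
  by exists [::] => x; rewrite in_nil; apply/esym/negP => px; apply: nr; exists x.
have /factor_theorem [q def_p] := px.
have q0 : q != 0 by apply: contraNneq p0 => q0; rewrite def_p q0 mul0r.
have [|//|rs rsP] := IHn q.
  by move: sp; rewrite def_p size_Mmonic ?monicXsubC // size_XsubC addn2.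
exists (x :: rs) => y; rewrite inE rsP def_p rootM root_XsubC orbC.
by rewrite eq_sym.
Qed.

Lemma map_poly_fixed (F : fieldType) (E : set F) (sigma : {rmorphism F -> F}) p :
  E 0 -> (forall x, E x -> sigma x = x) -> p \is a polyOver [in E] ->
  map_poly sigma p = p.
Proof.
by move=> E0 fixE /(polyOver_setP _ E0) Ep; apply/polyP => i; rewrite coef_map /= fixE.
Qed.

(** [sigma] maps the finite set of roots of a polynomial over [L] injectively into itself, hence
    onto itself, and every element is such a root. *)
Lemma fixing_bijective (F : fieldType) (L : set F) (sigma : {rmorphism F -> F}) :
  L 0 -> (forall x, algebraic_over L x) -> (forall x, L x -> sigma x = x) ->
  bijective sigma.
Proof.
move=> L0 algL fixL.
have surj y : exists x, sigma x = y.
  have [p [Lp p0 py]] := algL y.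
  have [rs rsP] := seq_roots p0.
  have smem x : x \in rs -> sigma x \in rs.
    by rewrite !rsP -{2}(map_poly_fixed L0 fixL Lp) !rootE horner_map => /eqP->; rewrite rmorph0.
  have urs : uniq (map sigma (undup rs)).
    by rewrite map_inj_uniq ?undup_uniq //; exact: fmorph_inj.
  have [|//|_ eq_rs] := uniq_min_size urs (s2 := undup rs).
  - by move=> x /mapP [z]; rewrite !mem_undup => /smem sz ->.
  - by rewrite size_map.
  have : y \in map sigma (undup rs) by rewrite eq_rs mem_undup rsP.
  by case/mapP => x _ ->; exists x.
have [f fP] := choice surj; exists f => // x.
by apply: (fmorph_inj sigma); rewrite fP.
Qed.

Section SeparableClosure.
Variables (S : fieldType) (L : set S).
Hypotheses (hL : subfield L) (hS : separable_closure_of L).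
Implicit Types (E : set S) (sigma : {rmorphism S -> S}).

Lemma separable_closure_algebraic x : algebraic_over L x.
Proof.
have [p [Lp sep_p px]] := hS.1 x.
by exists p; split=> //; exact: separable_poly_neq0.
Qed.

Lemma graph_lift (g : set (S * S)) (hg : field_graph g) (p : {poly S}) :
  (forall x, L x -> g (x, x)) -> p \is a polyOver [in L] ->
  exists P : {poly graph_type hg}, map_poly (@graph_fst _ _ hg) P = p /\
    map_poly (@graph_snd _ _ hg) P = p.
Proof.
move=> Lg /(polyOver_setP _ (subring0 (subfield_subring hL))) Lp.
pose f (x : S) : graph_type hg := insubd 0 (x, x).
have fE x : L x -> val (f x) = (x, x).
  by move=> /Lg /(graph_predE hg) gx; rewrite val_insubd gx.
have f0 : f 0 = 0.
  by apply: val_inj; rewrite fE //; exact: (subring0 (subfield_subring hL)).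
exists (map_poly f p); split; apply/polyP => i; rewrite coef_map coef_map_id0 //.
  by rewrite /= /graph_fst fE.
by rewrite /= /graph_snd fE.
Qed.

(** [L] lies on the diagonal of [g], so a separable polynomial of [y] over [L] has the same image
    under both projections. The irreducible polynomial divides it, and its second image inherits
    separability. *)
Lemma graph_irreducible (g : set (S * S)) (hg : field_graph g) y :
  (forall x, L x -> g (x, x)) ->
  exists p : {poly graph_type hg}, [/\ irreducible_poly p,
    root (map_poly (@graph_fst _ _ hg) p) y &
    separable_poly (map_poly (@graph_snd _ _ hg) p)].
Proof.
move=> Lg; have [q [Lq sep_q qy]] := hS.1 y.
have [Q [Q1 Q2]] := graph_lift hg Lg Lq.
have [||p irr_p py] := @exists_irreducible_root _ _ (@graph_fst _ _ hg) Q y.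
- by rewrite -(map_poly_eq0 (@graph_fst _ _ hg)) Q1 separable_poly_neq0.
- by rewrite Q1.
exists p; split=> //; apply: (dvdp_separable _ sep_q).
by rewrite -Q2 dvdp_map -(irreducible_root _ irr_p py) Q1.
Qed.

(** Zorn's lemma without further constraint: the transported irreducible polynomial of [y] is
    separable and nonconstant, so it has a root to which [y] can be sent. *)
Lemma graph_automorphism (g : set (S * S)) :
  field_graph g -> (forall x, L x -> g (x, x)) ->
  exists2 sigma, galois_aut L sigma & forall x y, g (x, y) -> sigma x = y.
Proof.
move=> hg Lg.
have [//|g' y hg' gg' _|sigma [sg _]] := @graph_extend_total S setT g hg.
  have Lg' x : L x -> g' (x, x) by move=> /Lg /gg'.
  have [p [irr_p py sep_p]] := graph_irreducible hg' y Lg'.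
  have [|y' py'] := hS.2 _ sep_p; first by rewrite size_map_poly; case: irr_p.
  have [g'' [hg'' gg'' g''y]] := graph_extend1 irr_p py py'.
  by exists g''; split=> //; exists y'.
exists sigma => //; have fixL x : L x -> sigma x = x by move=> /Lg /sg.
split=> //; apply: fixing_bijective fixL; last exact: separable_closure_algebraic.
exact: (subring0 (subfield_subring hL)).
Qed.

(** If the irreducible polynomial of [y] had degree above 1, separability would give a root [y']
    different from [y], and the diagonal of [E] together with [(y, y')] would extend to an
    automorphism moving [y]. *)
Lemma galois_fixed E y : subfield E -> L `<=` E ->
  (forall sigma, galois_aut E sigma -> sigma y = y) -> E y.
Proof.
move=> hE LE fixy.
pose g := [set (x, x) | x in E].
have hg : field_graph g.
  have rE := subfield_subring hE.
  apply: field_graphP => [|a b c d [x Ex [<- <-]] [z Ez [<- <-]]|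
    a b c d [x Ex [<- <-]] [z Ez [<- <-]]|a b [x _ [<- <-]] //].
  - by exists 1 => //; exact: (subring1 rE).
  - by exists (x - z) => //; exact: (subringB rE).
  - by exists (x / z) => //; apply: (subringM rE) => //; exact: (subfieldV hE).
have Lg x : L x -> g (x, x) by move=> /LE Ex; exists x.
have [p [irr_p py sep_p]] := graph_irreducible hg y Lg.
have eq_p : map_poly (@graph_fst _ _ hg) p = map_poly (@graph_snd _ _ hg) p.
  apply/polyP => i; rewrite !coef_map /=; case: p`_i => -[a b] ab.
  by rewrite /graph_fst /graph_snd /=; have /(graph_predE hg) [x _ [-> ->]] := ab.
have Ep i : E (map_poly (@graph_fst _ _ hg) p)`_i.
  rewrite coef_map /=; case: p`_i => -[a b] ab.
  by rewrite /graph_fst /=; have /(graph_predE hg) [x Ex [<- _]] := ab.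
set q := map_poly _ p in py sep_p eq_p Ep.
have sq : (1 < size q)%N by rewrite size_map_poly; case: irr_p.
have sep_q : separable_poly q by rewrite eq_p.
have /factor_theorem [r def_q] := py.
have r0 : r != 0.
  by apply: contraTneq sq => r0; rewrite def_q r0 mul0r size_poly0.
have [sr|sr] := ltnP 1 (size r).
  have : separable_poly r && ~~ root r y by rewrite -separable_root -def_q.
  move=> /andP [sep_r ry]; have [y' ry'] := hS.2 r sep_r sr.
  have [|g' [hg' gg' g'y]] := graph_extend1 irr_p py (y' := y').
    by rewrite -eq_p def_q rootM ry'.
  have [|sigma [sbij sL] sg] := graph_automorphism hg'.
    by move=> x /Lg /gg'.
  suff : sigma y = y by rewrite (sg _ _ g'y) => yy'; rewrite -yy' ry' in ry.
  by apply: fixy; split=> // x Ex; apply/sg/gg'; exists x.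
have /size1_polyC def_r := sr.
have rE := subfield_subring hE.
have q1 : E r`_0.
  have := Ep 1%N; rewrite def_q def_r mulrBr coefB coefCM coefX mulr1 -polyCM coefC subr0.
  by rewrite coefC.
have : E (r`_0 * y).
  have := Ep 0%N; rewrite def_q def_r mulrBr coefB coefCM coefX mulr0 -polyCM coefC sub0r.
  by rewrite coefC => /(subringN rE); rewrite opprK.
move=> /(subringM rE (subfieldV hE q1)); rewrite mulKf //.
by apply: contraNneq r0 => r00; rewrite def_r r00.
Qed.

End SeparableClosure.

(** * Galois orbits of finite tuples *)

Section GaloisAutomorphisms.
Variable S : fieldType.
Implicit Types (E : set S) (sigma tau : {rmorphism S -> S}) (s : seq S).

Lemma galois_aut_id E : galois_aut E (idfun : {rmorphism S -> S}).
Proof. by split=> //; exists idfun. Qed.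

Lemma galois_aut_comp E sigma tau : galois_aut E sigma -> galois_aut E tau ->
  galois_aut E (sigma \o tau : {rmorphism S -> S}).
Proof.
move=> [bs fs] [bt ft]; split; first exact: bij_comp.
by move=> x Ex /=; rewrite ft ?fs.
Qed.

Lemma galois_aut_inv E sigma : galois_aut E sigma ->
  exists2 tau : {rmorphism S -> S},
  galois_aut E tau & cancel sigma tau /\ cancel tau sigma.
Proof.
move=> [[f fK Kf] fixE]; have [|x y|x y|tau tauE] := @rmorphism_of_fun _ _ f.
- by rewrite -[X in f X](rmorph1 sigma) fK.
- by rewrite -{1}[x]Kf -{1}[y]Kf -rmorphB fK.
- by rewrite -{1}[x]Kf -{1}[y]Kf -rmorphM fK.
have tK : cancel sigma tau by move=> x; rewrite tauE fK.
have Kt : cancel tau sigma by move=> x; rewrite tauE Kf.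
exists tau => //; split; first by exists sigma.
by move=> x Ex; rewrite -{1}(fixE _ Ex) tK.
Qed.

Lemma galois_autS E E' sigma : E `<=` E' -> galois_aut E' sigma -> galois_aut E sigma.
Proof. by move=> EE' [? fixE']; split=> // x /EE' /fixE'. Qed.

Lemma adjoin_field_subfield (E T : set S) : subfield (adjoin_field E T).
Proof.
apply/subfieldP; split=> [X [] /subfieldP [] //|x y Ax Ay X XP|x y Ax Ay X XP].
  by have /subfieldP [_ XB _] := XP.1; apply: XB; [exact: Ax|exact: Ay].
by have /subfieldP [_ _ XD] := XP.1; apply: XD; [exact: Ax|exact: Ay].
Qed.

Lemma sub_adjoin_field (E T : set S) : E `<=` adjoin_field E T.
Proof. by apply: sub_smallest => x; left. Qed.

Lemma gen_adjoin_field (E T : set S) : T `<=` adjoin_field E T.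
Proof. by apply: sub_smallest => x; right. Qed.

Lemma adjoin_field_sub (E T X : set S) :
  subfield X -> E `<=` X -> T `<=` X -> adjoin_field E T `<=` X.
Proof. by move=> hX EX TX; apply: smallest_sub => // x [/EX|/TX]. Qed.

Lemma eq_adjoin_field (S' : fieldType) (sigma tau : {rmorphism S -> S'}) E s c :
  (forall x, E x -> sigma x = tau x) -> map sigma s = map tau s ->
  adjoin_field E [set` s] c -> sigma c = tau c.
Proof.
move=> eqE eqs; apply: (@adjoin_field_sub _ _ [set x | sigma x = tau x]) => //=.
  apply/subfieldP; split=> [|x y /= xE yE|x y /= xE yE]; first by rewrite /= !rmorph1.
    by rewrite /= !rmorphB xE yE.
  by rewrite /= !fmorph_div xE yE.
by move=> x /= xs; move/eq_in_map: eqs; exact.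
Qed.

(** An embedding over [E] of the field generated by [s] is determined by the image of the tuple [s].
    So [rs] lists these embeddings and [rho] picks an automorphism inducing each; tuples take the
    place of a primitive element. *)
Definition galois_orbit E s (rs : seq (seq S)) (rho : seq S -> {rmorphism S -> S}) :=
  [/\ uniq rs,
      forall z, z \in rs -> galois_aut E (rho z) /\ map (rho z) s = z &
      forall sigma, galois_aut E sigma -> map sigma s \in rs].

Section Orbit.
Variables (E : set S) (s : seq S) (rs : seq (seq S)) (rho : seq S -> {rmorphism S -> S}).
Hypothesis hrs : galois_orbit E s rs rho.

Lemma orbit_id : s \in rs.
Proof. by case: hrs => _ _ /(_ _ (galois_aut_id E)); rewrite map_id. Qed.

Lemma orbit_stable sigma z : galois_aut E sigma -> z \in rs -> map sigma z \in rs.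
Proof.
move=> hs; case: hrs => _ hr hm /hr [hz <-]; rewrite -map_comp.
exact: (hm _ (galois_aut_comp hs hz)).
Qed.

(** Both sides are embeddings that fix [E] and send [s] to [map sigma z]. Hence an automorphism acts
    on the conjugates [rho z c] by permuting the index [z]. *)
Lemma orbit_aut sigma z c : galois_aut E sigma -> z \in rs ->
  adjoin_field E [set` s] c -> sigma (rho z c) = rho (map sigma z) c.
Proof.
move=> hs hz; have hsz := orbit_stable hs hz; case: hrs => _ hr _.
have [[_ fz] mz] := hr _ hz; have [[_ fsz] msz] := hr _ hsz.
apply: (@eq_adjoin_field _ (sigma \o rho z : {rmorphism S -> S})) => /=.
  by move=> x Ex; rewrite fz // fsz //; case: hs => _; apply.
by rewrite msz map_comp mz.
Qed.

Lemma orbit_aut_id c : adjoin_field E [set` s] c -> rho s c = c.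
Proof.
have [[_ fz] mz] : galois_aut E (rho s) /\ map (rho s) s = s.
  by case: hrs => _ /(_ _ orbit_id).
apply: (@eq_adjoin_field _ _ (idfun : {rmorphism S -> S})) => //=.
by rewrite mz map_id.
Qed.

Lemma orbit_perm sigma : galois_aut E sigma -> perm_eq (map (map sigma) rs) rs.
Proof.
move=> hs; have urs : uniq rs by case: hrs.
have um : uniq (map (map sigma) rs).
  by rewrite map_inj_uniq //; apply: inj_map; exact: fmorph_inj.
apply: uniq_perm => //.
have [||//] := uniq_min_size um (s2 := rs).
  by move=> _ /mapP [z hz ->]; exact: orbit_stable.
by rewrite size_map.
Qed.

End Orbit.

(** Each entry of [s] can only go to a root of a fixed polynomial over [L]; the finitely many
    combinations are filtered by those that an automorphism realizes. *)
Lemma galois_orbit_exists (L : set S) E s : L `<=` E -> E 0 ->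
  (forall x, algebraic_over L x) -> exists rs rho, galois_orbit E s rs rho.
Proof.
move=> LE E0 algL.
have [cand candP] : exists cand : seq (seq S),
    forall sigma, galois_aut E sigma -> map sigma s \in cand.
  elim: s => [|a s [cand candP]]; first by exists [:: [::]].
  have [p [Lp p0 pa]] := algL a.
  have [rs rsP] := seq_roots p0.
  exists [seq x :: z | x <- rs, z <- cand] => sigma hs /=.
  apply/allpairsP; exists (sigma a, map sigma s); split=> //=; last exact: candP.
  have Ep : p \is a polyOver [in E].
    by apply/allP => x xp; move/allP: Lp => /(_ _ xp); rewrite !inE; exact: LE.
  rewrite rsP -(map_poly_fixed E0 hs.2 Ep) rootE horner_map.
  by move: pa; rewrite rootE => /eqP ->; rewrite rmorph0.
pose orb z := `[< exists2 sigma, galois_aut E sigma & map sigma s = z >].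
pose rs := undup (filter orb cand).
have /choice [rho rhoP] : forall z, exists sigma : {rmorphism S -> S}, z \in rs ->
    galois_aut E sigma /\ map sigma s = z.
  move=> z; have [|nz] := boolP (z \in rs); last by exists idfun.
  by rewrite mem_undup mem_filter => /andP [/asboolP [sigma hs <-] _]; exists sigma.
exists rs, rho; split=> //; first exact: undup_uniq.
move=> sigma hs; rewrite mem_undup mem_filter candP // andbT.
by apply/asboolP; exists sigma.
Qed.

Lemma galois_fixed_poly (L E : set S) (p : {poly S}) : subfield L ->
  separable_closure_of L -> subfield E -> L `<=` E ->
  (forall sigma, galois_aut E sigma -> map_poly sigma p = p) ->
  p \is a polyOver [in E].
Proof.
move=> hL hS hE LE fixp.
apply/polyOver_setP; first exact: (subring0 (subfield_subring hE)).
move=> i; apply: (galois_fixed hL hS hE LE) => sigma hs.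
by rewrite -{2}(fixp _ hs) coef_map.
Qed.

Section OrbitPolynomials.
Variables (L E : set S) (s : seq S) (rs : seq (seq S)).
Variables (rho : seq S -> {rmorphism S -> S}).
Hypotheses (hL : subfield L) (hS : separable_closure_of L).
Hypotheses (hE : subfield E) (LE : L `<=` E) (hrs : galois_orbit E s rs rho).
Variable h : seq S -> {poly S}.
Hypothesis hh : forall sigma z, galois_aut E sigma -> z \in rs ->
  map_poly sigma (h z) = h (map sigma z).

(** Automorphisms over [E] permute the factors, so the coefficients of the product are fixed and lie
    in [E]. *)
Lemma orbit_prod_over : \prod_(z <- rs) h z \is a polyOver [in E].
Proof.
apply: (galois_fixed_poly hL hS hE LE) => sigma hs; rewrite rmorph_prod.
rewrite (eq_big_seq (fun z => h (map sigma z))) => [|z]; last exact: hh.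
by rewrite -(big_map (map sigma) xpredT h); apply/perm_big/(orbit_perm hrs).
Qed.

Lemma orbit_sum_over : \sum_(z <- rs) h z \is a polyOver [in E].
Proof.
apply: (galois_fixed_poly hL hS hE LE) => sigma hs; rewrite rmorph_sum.
rewrite (eq_big_seq (fun z => h (map sigma z))) => [|z]; last exact: hh.
by rewrite -(big_map (map sigma) xpredT h); apply/perm_big/(orbit_perm hrs).
Qed.

End OrbitPolynomials.

(** The characteristic polynomial of [c] in the extension generated by [s]: conjugates are repeated
    when [c] generates a smaller field. *)
Definition orbit_poly rs (rho : seq S -> {rmorphism S -> S}) c : {poly S} :=
  \prod_(z <- rs) ('X - (rho z c)%:P).

Lemma orbit_poly_over (L E : set S) s rs rho c : subfield L ->
  separable_closure_of L -> subfield E -> L `<=` E -> galois_orbit E s rs rho ->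
  adjoin_field E [set` s] c -> orbit_poly rs rho c \is a polyOver [in E].
Proof.
move=> hL hS hE LE hrs Ec; apply: (orbit_prod_over hL hS hE LE hrs) => sigma z hs hz.
by rewrite rmorphB /= map_polyX map_polyC /= (orbit_aut hrs).
Qed.

End GaloisAutomorphisms.

(** * Valuation rings and integral closures *)

Section ValuationRing.
Variables (F : fieldType) (v : valuation F).
Local Notation O := (valuation_ring v).
Local Notation M := (valuation_ideal v).
Local Notation G := (value_group v).

Lemma og_addr_ge0 (x y : G) : 0 <= x -> 0 <= y -> 0 <= x + y.
Proof. by move=> x0 /(ordered_group_leD2l x); rewrite addr0; exact: le_trans. Qed.

Lemma valuation1 : v 1 = 0.
Proof.
have /eqP := @Defs.valM _ v _ _ (oner_neq0 F) (oner_neq0 F).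
by rewrite mulr1 -subr_eq0 opprD addNKr oppr_eq0 => /eqP.
Qed.

(** Meant for [v (-1)], whose double is [v 1]: a totally ordered group has no 2-torsion. *)
Lemma og_double_eq0 (a : G) : a + a = 0 -> a = 0.
Proof.
move=> aa; apply/eqP; rewrite eq_le; have /orP [a0|a0] := ordered_group_total 0 a.
  by rewrite a0 andbT; have := ordered_group_leD2l a a0; rewrite addr0 aa.
by rewrite a0 /=; have := ordered_group_leD2l a a0; rewrite addr0 aa.
Qed.

Lemma valuationN x : v (- x) = v x.
Proof.
have [->|x0] := eqVneq x 0; first by rewrite oppr0.
have N0 : -1 != 0 :> F by rewrite oppr_eq0 oner_eq0.
rewrite -mulN1r Defs.valM // [v (-1)]og_double_eq0 ?add0r //.
by rewrite -Defs.valM // mulrNN mulr1 valuation1.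
Qed.

Lemma valuationV x : x != 0 -> v x^-1 = - v x.
Proof.
move=> x0; apply/eqP; rewrite -addr_eq0 -Defs.valM ?invr_eq0 //.
by rewrite mulVf // valuation1.
Qed.

Lemma valuation_subring : subring O.
Proof.
apply/subringP; split=> [|x y|x y].
- by right; rewrite valuation1.
- have [->|x0] := eqVneq x 0.
    by rewrite sub0r => _ [->|y0]; [left; rewrite oppr0|right; rewrite valuationN].
  have [->|y0] := eqVneq y 0; first by rewrite subr0.
  move=> [xE|vx]; first by rewrite xE eqxx in x0.
  move=> [yE|vy]; first by rewrite yE eqxx in y0.
  have [->|xy] := eqVneq (x - y) 0; [by left|right].
  have y0' : - y != 0 by rewrite oppr_eq0.
  by apply: le_trans (@Defs.valD _ v _ _ x0 y0' xy); rewrite /Order.min valuationN; case: ifP.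
- have [->|x0] := eqVneq x 0; first by rewrite mul0r; left.
  have [->|y0] := eqVneq y 0; first by rewrite mulr0; left.
  move=> [xE|vx]; first by rewrite xE eqxx in x0.
  move=> [yE|vy]; first by rewrite yE eqxx in y0.
  by right; rewrite Defs.valM // og_addr_ge0.
Qed.

Lemma valuation_total x : O x \/ O x^-1.
Proof.
have [->|x0] := eqVneq x 0; first by left; left.
have /orP [v0|v0] := ordered_group_total 0 (v x); first by left; right.
right; right; rewrite valuationV //.
by have := ordered_group_leD2l (- v x) v0; rewrite addNr addr0.
Qed.

(** Describes the ideal through the ring alone, which is all that [extends] compares. *)
Lemma valuation_idealE x : M x <-> O x /\ (x = 0 \/ ~ O x^-1).
Proof.
have [->|x0] := eqVneq x 0; first by split=> // _; [split; left|left].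
have nx : x = 0 -> False by move=> xE; rewrite xE eqxx in x0.
split=> [[/nx//|vx]|[[/nx//|vx] [/nx//|nO]]].
  split; first by right; exact: ltW.
  right=> -[/eqP|]; first by rewrite invr_eq0 (negPf x0).
  rewrite valuationV // => /(ordered_group_leD2l (v x)); rewrite addrN addr0 => vx'.
  by have := lt_le_trans vx vx'; rewrite ltxx.
right; rewrite lt_neqAle vx andbT; apply/negP => /eqP v0; apply: nO.
by right; rewrite valuationV // -v0 oppr0.
Qed.

Lemma valuation_ideal_sub : M `<=` O.
Proof. by move=> x /valuation_idealE []. Qed.

Lemma valuation_unit x : O x -> ~ M x -> O x^-1.
Proof.
move=> Ox Mx; apply: contrapT => nO; apply: Mx; apply/valuation_idealE.
by split=> //; right.
Qed.

Lemma valuation_ideal0 : M 0. Proof. by left. Qed.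

Lemma valuation_ideal1 : ~ M 1.
Proof. by case=> [/eqP|]; rewrite ?oner_eq0 // valuation1 ltxx. Qed.

Lemma valuation_nideal_neq0 x : ~ M x -> x != 0.
Proof. by move=> Mx; apply/eqP => x0; apply: Mx; left. Qed.

Lemma valuation_idealMl a x : O a -> M x -> M (a * x).
Proof.
move=> Oa /valuation_idealE [Ox hx]; apply/valuation_idealE; split.
  exact: (subringM valuation_subring).
have [->|x0] := eqVneq x 0; first by rewrite mulr0; left.
have [->|a0] := eqVneq a 0; first by rewrite mul0r; left.
right; rewrite invfM => Oax; case: hx => [xE|]; first by rewrite xE eqxx in x0.
by apply; have := subringM valuation_subring Oa Oax; rewrite mulrA mulfV // mul1r.
Qed.

Lemma valuation_idealMr a x : O a -> M x -> M (x * a).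
Proof. by rewrite mulrC; exact: valuation_idealMl. Qed.

Lemma valuation_prime x y : O x -> O y -> M (x * y) -> M x \/ M y.
Proof.
move=> Ox Oy Mxy; apply: contrapT => /not_orP [Mx My].
apply: My; rewrite -[y](mulKf (valuation_nideal_neq0 Mx)).
by apply: valuation_idealMl => //; exact: valuation_unit.
Qed.

Lemma valuation_idealD x y : M x -> M y -> M (x + y).
Proof.
have [->|x0] := eqVneq x 0; first by rewrite add0r.
have [->|y0] := eqVneq y 0; first by rewrite addr0.
move=> [xE|vx]; first by rewrite xE eqxx in x0.
move=> [yE|vy]; first by rewrite yE eqxx in y0.
have [->|xy] := eqVneq (x + y) 0; [by left|right].
by apply: lt_le_trans (@Defs.valD _ v _ _ x0 y0 xy); rewrite /Order.min; case: ifP.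
Qed.

Lemma valuation_idealB x y : M x -> M y -> M (x - y).
Proof.
move=> Mx My; apply: valuation_idealD => //; rewrite -mulN1r.
apply: valuation_idealMl => //; apply: (subringN valuation_subring).
exact: (subring1 valuation_subring).
Qed.

Lemma valuation_prod_unit (I : eqType) (r : seq I) (f : I -> F) :
  (forall i, i \in r -> O (f i) /\ ~ M (f i)) ->
  O (\prod_(i <- r) f i) /\ ~ M (\prod_(i <- r) f i).
Proof.
move=> fP; rewrite big_seq; elim/big_ind: _ => [|x y [Ox Mx] [Oy My]|//].
  by split; [exact: (subring1 valuation_subring)|exact: valuation_ideal1].
split; first exact: (subringM valuation_subring).
by move=> /(valuation_prime Ox Oy) [].
Qed.

(** [e] is an entry of least value; dividing a polynomial by such a coefficient makes it
    primitive. *)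
Lemma valuation_min_seq (t : seq F) : has (fun a => a != 0) t ->
  exists e, [/\ e \in t, e != 0 & forall a, a \in t -> O (a / e)].
Proof.
have O0 := subring0 valuation_subring; have O1 := subring1 valuation_subring.
elim: t => //= b t IHt; have [tn0|/hasPn t0] := boolP (has (fun a => a != 0) t).
  have [e [et e0 eO]] := IHt tn0 => _.
  have [Obe|Oeb] := valuation_total (b / e).
    by exists e; rewrite inE et orbT; split=> // a; rewrite inE => /predU1P [->|/eO].
  have [b0|b0] := eqVneq b 0.
    exists e; rewrite inE et orbT; split=> // a; rewrite inE => /predU1P [->|/eO] //.
    by rewrite b0 mul0r.
  exists b; rewrite mem_head; split=> // a; rewrite inE => /predU1P [->|at_].
    by rewrite divff.
  rewrite invf_div in Oeb; have := subringM valuation_subring (eO _ at_) Oeb.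
  by rewrite mulrA divfK.
rewrite orbF => b0; exists b; rewrite mem_head; split=> // a.
rewrite inE => /predU1P [->|/t0]; first by rewrite divff.
by rewrite negbK => /eqP ->; rewrite mul0r.
Qed.

End ValuationRing.

Section IntegralClosure.
Variables (F : fieldType) (A : set F).
Hypothesis hA : subring A.

Lemma integral_overE x : integral_over A x <->
  integralOver (val : subring_type hA -> F) x.
Proof.
split=> [[p [Ap mon_p px]]|[p mon_p px]]; last first.
  exists (map_poly val p); split=> //; last exact: monic_map.
  apply/(polyOver_setP _ (subring0 hA)) => i; rewrite coef_map.
  by apply/(subring_predE hA)/(valP p`_i).
have pE : map_poly val (map_poly (insubd (0 : subring_type hA)) p) = p.
  apply/polyP => i; rewrite coef_map /= coef_map_id0.
    rewrite val_insubd; case: ifP => // /negP []; apply/(subring_predE hA).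
    by move/(polyOver_setP _ (subring0 hA)): Ap.
  by apply: val_inj; rewrite val_insubd; case: ifP.
exists (map_poly (insubd (0 : subring_type hA)) p); last by rewrite pE.
apply/monicP/val_inj; rewrite -(lead_coef_map_inj val_inj) ?rmorph0 // pE.
exact/monicP.
Qed.

Lemma integral_over_id x : A x -> integral_over A x.
Proof.
move=> Ax; exists ('X - x%:P); rewrite monicXsubC root_XsubC eqxx; split=> //.
rewrite polyOver_subringE polyOverXsubC; exact/subring_predE.
Qed.

Lemma integral_over_subring : subring (integral_over A).
Proof.
apply/subringP; split=> [|x y|x y].
- exact/integral_over_id/(subring1 hA).
- by move=> /integral_overE Ax /integral_overE Ay; apply/integral_overE/integral_sub.
- by move=> /integral_overE Ax /integral_overE Ay; apply/integral_overE/integral_mul.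
Qed.

Lemma integral_over_trans p x : p \is monic -> root p x ->
  (forall i, integral_over A p`_i) -> integral_over A x.
Proof.
move=> mon_p px Cp; apply/integral_overE; apply: integral_root_monic mon_p px _.
by apply/integral_poly => i; apply/integral_overE.
Qed.

Lemma integral_over_aut (L : set F) (sigma : {rmorphism F -> F}) x :
  A `<=` L -> (forall x, L x -> sigma x = x) ->
  integral_over A x -> integral_over A (sigma x).
Proof.
move=> AL fixL [p [Ap mon_p px]]; exists p; split=> //.
have fixA y : A y -> sigma y = y by move/AL/fixL.
rewrite -(map_poly_fixed (subring0 hA) fixA Ap) rootE horner_map.
by move: px; rewrite rootE => /eqP ->; rewrite rmorph0.
Qed.

(** If [x] were outside [O], then [x^-1] would be in [M], and dividing the monic equation by
    [x ^+ n] would put 1 in [M]. *)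
Lemma integral_over_valuation (v : valuation F) x :
  A `<=` valuation_ring v -> integral_over A x -> valuation_ring v x.
Proof.
move=> AO [p [/(polyOver_setP _ (subring0 hA)) Ap mon_p px]].
have hO := valuation_subring v.
have [//|Oy] := valuation_total v x.
have [->|x0] := eqVneq x 0; first exact: (subring0 hO).
apply: contrapT => nOx.
have My : valuation_ideal v x^-1 by apply/valuation_idealE; rewrite invrK; split=> //; right.
have sp : (0 < size p)%N by rewrite size_poly_gt0 monic_neq0.
have [n sn] : exists n, size p = n.+1 by exists (size p).-1; rewrite prednK.
have : x ^+ n = - \sum_(i < n) p`_i * x ^+ i.
  have := px; rewrite rootE horner_coef sn big_ord_recr /=.
  move/monicP: mon_p; rewrite lead_coefE sn /= => ->.
  by rewrite mul1r addrC addr_eq0 => /eqP.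
move/(congr1 (fun y => y * x^-1 ^+ n)).
rewrite -exprMn mulfV // expr1n mulNr mulr_suml => e1.
apply: (@valuation_ideal1 _ v); rewrite e1 -sub0r.
apply: valuation_idealB; first exact: valuation_ideal0.
elim/big_ind: _ => [|y z|i _]; [exact: valuation_ideal0|exact: valuation_idealD|].
rewrite -mulrA; apply: valuation_idealMl; first exact: AO.
have -> : x ^+ i * x^-1 ^+ n = x^-1 ^+ (n - i).-1 * x^-1.
  rewrite -exprSr prednK ?subn_gt0 //.
  case: i => i lt_in /=; have [j ->] : exists j, n = (j + i)%N.
    by exists (n - i)%N; rewrite subnK // ltnW.
  by rewrite addnK exprD mulrCA -exprMn mulfV // expr1n mulr1.
by apply: valuation_idealMl => //; exact: (subringX hO).
Qed.

End IntegralClosure.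

(** * Residue fields *)

(** A total function that is a ring homomorphism on [B] and arbitrary elsewhere, as is the case for
    [residue] and its composites with automorphisms. *)
Definition hom_on (F : fieldType) (Omega : pzRingType) (B : set F) (psi : F -> Omega) :=
  [/\ psi 1 = 1, forall x y, B x -> B y -> psi (x - y) = psi x - psi y &
      forall x y, B x -> B y -> psi (x * y) = psi x * psi y].

Section ResidueField.
Variables (F : fieldType) (v : valuation F).
Local Notation O := (valuation_ring v).
Local Notation M := (valuation_ideal v).

(** [xget] chooses from a set that depends only on the class of [x], so congruent elements get the
    same representative. *)
Definition residue_rep (x : F) : F := xget 0 [set y | M (x - y)].

Lemma residue_repP x : M (x - residue_rep x).
Proof.
have : [set y | M (x - y)] x by rewrite /= subrr; exact: valuation_ideal0.
exact: xgetI.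
Qed.

Lemma residue_rep_eq x y : M (x - y) -> residue_rep x = residue_rep y.
Proof.
move=> Mxy; rewrite /residue_rep; congr (xget _ _); apply/seteqP; split=> z /= Mz.
  by have := valuation_idealB Mz Mxy; rewrite opprB addrC addrA subrK.
by have := valuation_idealD Mxy Mz; rewrite addrA subrK.
Qed.

Lemma residue_rep_idem x : residue_rep (residue_rep x) = residue_rep x.
Proof.
apply/residue_rep_eq; rewrite -opprB -sub0r.
by apply: valuation_idealB (residue_repP x); exact: valuation_ideal0.
Qed.

Lemma residue_rep_valued x : O x -> O (residue_rep x).
Proof.
move=> Ox; rewrite -[residue_rep x](subKr x).
apply: (subringB (valuation_subring v)) => //.
exact/valuation_ideal_sub/residue_repP.
Qed.

(* Canonical representatives of the classes of [O / M]. *)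
Record residue_field := ResidueField
  { residue_val :> F; _ : `[< O residue_val /\ residue_rep residue_val = residue_val >] }.

HB.instance Definition _ := [isSub for residue_val].
HB.instance Definition _ := [Choice of residue_field by <:].

Fact residue_subproof x : `[< O (if `[< O x >] then residue_rep x else residue_rep 0) /\
  residue_rep (if `[< O x >] then residue_rep x else residue_rep 0) =
  (if `[< O x >] then residue_rep x else residue_rep 0) >].
Proof.
apply/asboolP; case: asboolP => Ox; rewrite residue_rep_idem; split=> //.
  exact: residue_rep_valued.
exact/residue_rep_valued/(subring0 (valuation_subring v)).
Qed.

(* Outside of [O] the value is the junk [0]. *)
Definition residue x : residue_field := ResidueField (residue_subproof x).

Lemma residueE x : O x -> val (residue x) = residue_rep x.
Proof. by move=> Ox /=; case: asboolP. Qed.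

Lemma residue_eq x y : O x -> O y -> (residue x = residue y <-> M (x - y)).
Proof.
move=> Ox Oy; split=> [/(congr1 val)|Mxy]; last first.
  by apply: val_inj; rewrite !residueE //; exact: residue_rep_eq.
rewrite !residueE // => exy.
have := valuation_idealB (residue_repP x) (residue_repP y).
by rewrite exy opprB addrA subrK.
Qed.

Lemma residue_valP (a : residue_field) : O (val a).
Proof. by case: a => x /= /asboolP []. Qed.

Lemma residueK (a : residue_field) : residue (val a) = a.
Proof.
apply: val_inj; rewrite residueE; last exact: residue_valP.
by case: a => x /= /asboolP [].
Qed.

Let hO := valuation_subring v.

Definition residue_add (a b : residue_field) := residue (val a + val b).
Definition residue_opp (a : residue_field) := residue (- val a).
Definition residue_mul (a b : residue_field) := residue (val a * val b).
Definition residue_inv (a : residue_field) :=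
  if a == residue 0 then a else residue (val a)^-1.

Lemma residue_valE x : O x -> M (val (residue x) - x).
Proof.
move=> Ox; apply/residue_eq => //; first exact: residue_valP.
exact: residueK.
Qed.

Lemma residue_addE x y : O x -> O y -> residue_add (residue x) (residue y) = residue (x + y).
Proof.
move=> Ox Oy; apply/residue_eq.
- by apply: (subringD hO); exact: residue_valP.
- exact: (subringD hO).
- rewrite opprD addrACA.
  by apply: valuation_idealD; exact: residue_valE.
Qed.

Lemma residue_oppE x : O x -> residue_opp (residue x) = residue (- x).
Proof.
move=> Ox; apply/residue_eq.
- by apply: (subringN hO); exact: residue_valP.
- exact: (subringN hO).
- rewrite -opprD -sub0r; apply: valuation_idealB; first exact: valuation_ideal0.
  exact: residue_valE.
Qed.

Lemma residue_mulE x y : O x -> O y -> residue_mul (residue x) (residue y) = residue (x * y).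
Proof.
move=> Ox Oy; apply/residue_eq.
- by apply: (subringM hO); exact: residue_valP.
- exact: (subringM hO).
- set a := val _; set b := val _.
  have -> : a * b - x * y = a * (b - y) + (a - x) * y.
    by rewrite mulrBr mulrBl addrA subrK.
  apply: valuation_idealD.
    by apply: valuation_idealMl; [exact: residue_valP|exact: residue_valE].
  by apply: valuation_idealMr => //; exact: residue_valE.
Qed.

Lemma residue_ind (P : residue_field -> Prop) : (forall x, O x -> P (residue x)) -> forall a, P a.
Proof. by move=> h a; rewrite -[a]residueK; exact/h/residue_valP. Qed.

Let OD := subringD hO.
Let OM := subringM hO.
Let ON := subringN hO.
Let O0 := subring0 hO.
Let O1 := subring1 hO.

Fact residue_addA : associative residue_add.
Proof.
elim/residue_ind=> x Ox; elim/residue_ind=> y Oy; elim/residue_ind=> z Oz.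
by rewrite !residue_addE ?addrA //; exact: OD.
Qed.
Fact residue_addC : commutative residue_add.
Proof.
by elim/residue_ind=> x Ox; elim/residue_ind=> y Oy; rewrite !residue_addE // addrC.
Qed.
Fact residue_add0 : left_id (residue 0) residue_add.
Proof. by elim/residue_ind=> x Ox; rewrite residue_addE // add0r. Qed.
Fact residue_addN : left_inverse (residue 0) residue_opp residue_add.
Proof. by elim/residue_ind=> x Ox; rewrite residue_oppE // residue_addE ?addNr //; exact: ON. Qed.

HB.instance Definition _ := GRing.isZmodule.Build residue_field
  residue_addA residue_addC residue_add0 residue_addN.

Fact residue_mulA : associative residue_mul.
Proof.
elim/residue_ind=> x Ox; elim/residue_ind=> y Oy; elim/residue_ind=> z Oz.
by rewrite !residue_mulE ?mulrA //; exact: OM.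
Qed.
Fact residue_mulC : commutative residue_mul.
Proof.
by elim/residue_ind=> x Ox; elim/residue_ind=> y Oy; rewrite !residue_mulE // mulrC.
Qed.
Fact residue_mul1 : left_id (residue 1) residue_mul.
Proof. by elim/residue_ind=> x Ox; rewrite residue_mulE // mul1r. Qed.
Fact residue_mulDl : left_distributive residue_mul residue_add.
Proof.
elim/residue_ind=> x Ox; elim/residue_ind=> y Oy; elim/residue_ind=> z Oz.
have xyO := OD Ox Oy; have xzO := OM Ox Oz; have yzO := OM Oy Oz.
rewrite (residue_addE Ox Oy) (residue_mulE xyO Oz) (residue_mulE Ox Oz).
by rewrite (residue_mulE Oy Oz) (residue_addE xzO yzO) mulrDl.
Qed.
Fact residue_1neq0 : residue 1 != residue 0.
Proof. by apply/eqP => /(residue_eq O1 O0); rewrite subr0; exact: valuation_ideal1. Qed.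

HB.instance Definition _ := GRing.Zmodule_isComNzRing.Build residue_field
  residue_mulA residue_mulC residue_mul1 residue_mulDl residue_1neq0.

Lemma residue_eq0 x : O x -> (residue x = 0 <-> M x).
Proof. by move=> Ox; rewrite -[x in M x]subr0; exact: residue_eq. Qed.

Fact residue_mulVf (a : residue_field) : a != 0 -> residue_inv a * a = 1.
Proof.
elim/residue_ind: a => x Ox x0; rewrite /residue_inv (negPf x0).
have Mx : ~ M (val (residue x)).
  by move=> /(residue_eq0 (residue_valP _)); rewrite residueK; exact/eqP.
have OV := valuation_unit (residue_valP (residue x)) Mx.
rewrite -{2}[residue x]residueK [LHS]residue_mulE //; last exact: residue_valP.
by rewrite mulVf //; exact: (valuation_nideal_neq0 Mx).
Qed.
Fact residue_inv0 : residue_inv 0 = 0.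
Proof. by rewrite /residue_inv eqxx. Qed.

HB.instance Definition _ := GRing.ComNzRing_isField.Build residue_field
  residue_mulVf residue_inv0.

Lemma residue_hom : hom_on O residue.
Proof.
split=> // x y Ox Oy; last by rewrite -residue_mulE.
rewrite -residue_addE //; last exact: ON.
by rewrite -residue_oppE.
Qed.

End ResidueField.

(** * Separation of residue homomorphisms *)

Section HomOn.
Variables (F Omega : fieldType) (B : set F) (psi : F -> Omega).
Hypotheses (hB : subring B) (hpsi : hom_on B psi).

Lemma hom_on1 : psi 1 = 1. Proof. by case: hpsi. Qed.

Lemma hom_onB x y : B x -> B y -> psi (x - y) = psi x - psi y.
Proof. by case: hpsi => _ h _; exact: h. Qed.

Lemma hom_onM x y : B x -> B y -> psi (x * y) = psi x * psi y.
Proof. by case: hpsi => _ _; apply. Qed.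

Lemma hom_on0 : psi 0 = 0.
Proof. by rewrite -(subrr (1 : F)) hom_onB ?subrr //; exact: subring1. Qed.

Lemma hom_onN x : B x -> psi (- x) = - psi x.
Proof. by move=> Bx; rewrite -sub0r hom_onB ?hom_on0 ?sub0r //; exact: subring0. Qed.

Lemma hom_onD x y : B x -> B y -> psi (x + y) = psi x + psi y.
Proof.
move=> Bx By; rewrite -[y]opprK hom_onB ?hom_onN //; exact: subringN.
Qed.

Lemma hom_onX x n : B x -> psi (x ^+ n) = psi x ^+ n.
Proof.
move=> Bx; elim: n => [|n IHn]; first by rewrite !expr0 hom_on1.
by rewrite !exprS hom_onM ?IHn //; exact: subringX.
Qed.

End HomOn.

Section FiniteSets.

Fixpoint words (T : Type) (n : nat) (s : seq T) : seq (seq T) :=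
  if n is n'.+1 then [seq x :: w | x <- s, w <- words n' s] else [:: [::]].

Lemma mem_words (T : eqType) n (s w : seq T) :
  size w = n -> {subset w <= s} -> w \in words n s.
Proof.
elim: n w => [|n IHn] [|x w] //= [sw] sub_w.
apply/allpairsP; exists (x, w); split=> //=; first by rewrite sub_w ?mem_head.
by apply: IHn => // y yw; rewrite sub_w // inE yw orbT.
Qed.

(** There are finitely many such [q], each with finitely many roots. *)
Lemma bounded_degree_roots_finite (Omega : fieldType) (s : seq Omega) n :
  exists U : seq Omega, forall (q : {poly Omega}) z, q != 0 -> (size q <= n)%N ->
    (forall i, q`_i \in s) -> root q z -> z \in U.
Proof.
have /choice [r rP] : forall q : {poly Omega}, exists rs : seq Omega,
    q != 0 -> forall z, (z \in rs) = root q z.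
  move=> q; have [q0|q0] := eqVneq q 0; first by exists [::].
  by have [rs rsP] := seq_roots q0; exists rs.
exists (flatten [seq r q | q <- map (@Poly Omega) (words n s)]) => q z q0 sq qs qz.
apply/flatten_mapP; exists q; last by rewrite rP.
apply/mapP; exists (mkseq (nth 0 q) n).
  apply: mem_words; first by rewrite size_mkseq.
  by move=> _ /mapP [i _ ->]; exact: qs.
apply/polyP => i; rewrite coef_Poly; case: (ltnP i n) => hi; first by rewrite nth_mkseq.
by rewrite !nth_default // ?size_mkseq // (leq_trans sq).
Qed.

(** Among the first [(size U).+1] powers two coincide, so the order of [z] is at most [size U]. The
    factorial is a common multiple of all such orders, so one exponent serves every [z]. *)
Lemma exprn_fact_eq1 (Omega : fieldType) (U : seq Omega) z :
  z != 0 -> (forall k, z ^+ k \in U) -> z ^+ (size U)`! = 1.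
Proof.
move=> z0 zU; pose t := mkseq (fun k => z ^+ k) (size U).+1.
have : ~~ uniq t.
  apply/negP => ut; have := uniq_leq_size ut (s2 := U).
  rewrite size_mkseq ltnn => h; suff : false by []; apply: h.
  by move=> _ /mapP [k _ ->].
move=> /(uniqPn 0) [i [j [ij]]]; rewrite size_mkseq ltnS => jU.
rewrite !nth_mkseq //; last by rewrite ltnS (leq_trans (ltnW ij)).
move=> eq_ij; have z1 : z ^+ (j - i) = 1.
  apply: (mulfI (expf_neq0 i z0)).
  by rewrite -exprD subnKC ?mulr1 ?eq_ij // ltnW.
have /dvdnP [k ->] : (j - i %| (size U)`!)%N.
  by apply: dvdn_fact; rewrite subn_gt0 ij (leq_trans (leq_subr _ _)).
by rewrite mulnC exprM z1 expr1n.
Qed.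

(** Multiplication by an element permutes [rs], so comparing products makes every element a root of
    unity of order dividing [size rs]; as many distinct roots of unity include a primitive one. *)
Lemma mul_closed_generator (Omega : fieldType) (rs : seq Omega) :
  uniq rs -> 1 \in rs -> 0 \notin rs ->
  (forall x y, x \in rs -> y \in rs -> x * y \in rs) ->
  exists2 zeta, zeta \in rs & forall z, z \in rs -> exists i, z = zeta ^+ i.
Proof.
move=> urs rs1 rs0 rsM.
have n_gt0 : (0 < size rs)%N by case: (rs) rs1.
have unity z : z \in rs -> (size rs).-unity_root z.
  move=> zrs; rewrite unity_rootE; apply/eqP.
  have z0 : z != 0 by apply: contraNneq rs0 => <-.
  have um : uniq (map ( *%R z) rs) by rewrite map_inj_uniq //; exact: mulfI.
  have [||_ eq_rs] := uniq_min_size um (s2 := rs).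
  - by move=> _ /mapP [y yrs ->]; exact: rsM.
  - by rewrite size_map.
  have prod0 : \prod_(y <- rs) y != 0.
    by rewrite prodf_seq_neq0; apply/allP => y yrs /=; apply: contraNneq rs0 => <-.
  apply: (mulIf prod0); rewrite mul1r -[RHS](perm_big _ (uniq_perm um urs eq_rs)).
  by rewrite big_map big_split /= big_const_seq count_predT -Monoid.iteropE.
have /hasP [zeta zrs prim] : has (size rs).-primitive_root rs.
  by apply: has_prim_root => //; apply/allP.
exists zeta => // z /unity; rewrite unity_rootE => /eqP /(prim_rootP prim) [i ->].
by exists i.
Qed.

End FiniteSets.

Section Separation.
Variables (F Omega : fieldType) (A B : set F) (I : eqType).
Variables (psi0 : F -> Omega) (psi : I -> F -> Omega).
Hypotheses (hB : subring B) (AB : A `<=` B) (h0 : hom_on B psi0).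

(* With residue field [psi0 @` A] infinite, one moves along a line. *)
Lemma separation_infinite (js : seq I) : (forall j, j \in js -> hom_on B (psi j)) ->
  (forall j a, j \in js -> A a -> psi j a = psi0 a) ->
  (forall j, j \in js -> exists2 b, B b & psi j b != psi0 b) ->
  (forall s : seq Omega, exists2 a, A a & psi0 a \notin s) ->
  exists2 b, B b & forall j, j \in js -> psi j b != psi0 b.
Proof.
elim: js => [|j js IHjs] hj agree sep inf; first by exists 0 => //; exact: subring0.
have [||||b Bb bP] := IHjs => //.
- by move=> i ijs; apply: hj; rewrite inE ijs orbT.
- by move=> i a ijs; apply: agree; rewrite inE ijs orbT.
- by move=> i ijs; apply: sep; rewrite inE ijs orbT.
have [c Bc cP] := sep j (mem_head _ _).
(* When [c] separates [psi i] from [psi0], [t i] is the only residue of [a] for which [b + a * c]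
   does not. *)
pose t i := - (psi i b - psi0 b) / (psi i c - psi0 c).
have [a Aa aP] := inf (map t (j :: js)).
have Ba := AB Aa; have Bac : B (a * c) by exact: subringM.
exists (b + a * c) => [|i ijs]; first exact: subringD.
have hi := hj _ ijs.
rewrite (hom_onD hB hi) // (hom_onD hB h0) // (hom_onM hi) // (hom_onM h0) //.
rewrite (agree _ _ ijs Aa) -subr_eq0 opprD addrACA -mulrBr.
have [ci|ci] := eqVneq (psi i c) (psi0 c).
  rewrite ci subrr mulr0 addr0 subr_eq0; apply: bP.
  by move: ijs; rewrite inE => /predU1P [ij|//]; rewrite -ij ci eqxx in cP.
rewrite addrC addr_eq0; apply: contra aP => /eqP e.
apply/mapP; exists i => //; rewrite /t -e mulfK //.
by rewrite subr_eq0.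
Qed.

(* With residue field [psi0 @` A] finite, every ring [psi j @` B] is finite: a
   generator of the multiplicative group of [psi0 @` B] distinguishes [psi0] from
   the [psi j] with the same kernel, and an idempotent takes care of the others. *)
Lemma separation_finite (js : seq I) (U : seq Omega) :
  (forall j, j \in js -> hom_on B (psi j)) ->
  (forall j, j \in js -> exists2 b, B b & psi j b != psi0 b) ->
  (forall b, B b -> psi0 b \in U) ->
  (forall j b, j \in js -> B b -> psi j b \in U) ->
  exists2 b, B b & forall j, j \in js -> psi j b != psi0 b.
Proof.
move=> hj sep U0 Uj; set N := (size U)`!.
have N_gt0 : (0 < N)%N by exact: fact_gt0.
(* Nonzero values are roots of unity of order dividing [N], so [b ^+ N] only takes the values 0 and
   1. *)
have powN j b : j \in js -> B b -> psi j b ^+ N = (psi j b != 0)%:R.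
  move=> jjs Bb; have [->|b0] := eqVneq (psi j b) 0.
    by rewrite expr0n -[N == 0%N]negbK -lt0n N_gt0.
  apply: exprn_fact_eq1 => // k; rewrite -(hom_onX hB (hj _ jjs)) //.
  by apply: Uj => //; exact: subringX.
have B1 := subring1 hB.
pose ker j := exists2 b, B b & psi0 b = 0 /\ psi j b != 0.
(* [e] is a product of factors [1 - b ^+ N], where [b] is in the kernel of [psi0] but not in that of
   [psi j]: such a factor is 1 under [psi0] and 0 under [psi j]. *)
have [e Be [e0 e01 eP]] : exists2 e, B e & [/\ psi0 e = 1,
    forall i, i \in js -> psi i e = 0 \/ psi i e = 1 &
    forall j, j \in js -> ker j -> psi j e = 0].
  suff : forall js' : seq I, {subset js' <= js} -> exists2 e, B e & [/\ psi0 e = 1,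
      forall i, i \in js -> psi i e = 0 \/ psi i e = 1 &
      forall j, j \in js' -> ker j -> psi j e = 0] by apply.
  elim=> [_|j js' IHjs sub].
    exists 1 => //; split=> [|i ijs|//]; first exact: (hom_on1 h0).
    by right; exact: (hom_on1 (hj _ ijs)).
  have [|e Be [e0 e01 eP]] := IHjs; first by move=> i ijs; apply: sub; rewrite inE ijs orbT.
  have [[b Bb [b0 bj]]|nker] := pselect (ker j); last first.
    exists e => //; split=> // i; rewrite inE => /predU1P [->//|]; exact: eP.
  have BbN : B (b ^+ N) by exact: subringX.
  have B1b : B (1 - b ^+ N) by exact: subringB.
  have ev i : i \in js -> psi i (e * (1 - b ^+ N)) = psi i e * (1 - (psi i b != 0)%:R).
    move=> ijs; have hi := hj _ ijs.
    by rewrite (hom_onM hi) // (hom_onB hi) // (hom_on1 hi) (hom_onX hB hi) // powN.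
  exists (e * (1 - b ^+ N)); first exact: subringM.
  split.
  - rewrite (hom_onM h0) // (hom_onB h0) // (hom_on1 h0) (hom_onX hB h0) // b0.
    by rewrite expr0n -[N == 0%N]negbK -lt0n N_gt0 subr0 e0 mulr1.
  - move=> i ijs; rewrite ev //; case: (_ != 0); first by rewrite subrr mulr0; left.
    by rewrite subr0 mulr1; exact: e01.
  - move=> i ijs ki; rewrite ev; last exact: sub.
    move: ijs; rewrite inE => /predU1P [->|ijs]; first by rewrite bj subrr mulr0.
    by rewrite eP ?mul0r.
(* The nonzero values of [psi0] on [B], a finite cyclic group. *)
pose rs := undup [seq z <- U | `[< z != 0 /\ exists2 b, B b & psi0 b = z >]].
have rsP z : z \in rs <-> z != 0 /\ exists2 b, B b & psi0 b = z.
  rewrite mem_undup mem_filter; split=> [/andP [/asboolP //]|zP].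
  by apply/andP; split; [exact/asboolP|case: zP => _ [b Bb <-]; exact: U0].
have [||||zeta] := @mul_closed_generator _ rs.
- exact: undup_uniq.
- by apply/rsP; rewrite oner_eq0; split=> //; exists 1 => //; exact: (hom_on1 h0).
- by apply/negP => /rsP []; rewrite eqxx.
- move=> a b /rsP [a0 [x Bx xa]] /rsP [b0 [y By yb]]; apply/rsP.
  rewrite mulf_neq0 //; split=> //; exists (x * y); first exact: subringM.
  by rewrite (hom_onM h0) // xa yb.
move=> /rsP [z0 [g Bg g_zeta]] zetaP.
exists (e * g); first exact: subringM.
move=> j jjs; have hpsi := hj _ jjs.
rewrite (hom_onM hpsi) // (hom_onM h0) // e0 mul1r g_zeta.
have [->|ej] := e01 _ jjs; first by rewrite mul0r eq_sym.
rewrite ej mul1r; apply/negP => /eqP gj.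
have [b Bb] := sep _ jjs; apply/negP; rewrite negbK.
(* As [psi j e = 1], the kernel of [psi0] lies in that of [psi j]. Agreement at the generator [g]
   then spreads to the powers of [g] and to all of [B], against [sep]. *)
have kerj c : B c -> psi0 c = 0 -> psi j c = 0.
  move=> Bc c0; apply: contrapT => /eqP cj; have := eP _ jjs.
  rewrite ej => h; have /eqP : (1 : Omega) = 0 by apply: h; exists c.
  by rewrite oner_eq0.
have [b0|b0] := eqVneq (psi0 b) 0; first by rewrite kerj // b0.
have [|i bi] := zetaP (psi0 b); first by apply/rsP; split=> //; exists b.
have Bgi : B (g ^+ i) by exact: subringX.
have : psi j (b - g ^+ i) = 0.
  apply: kerj; first exact: subringB.
  by rewrite (hom_onB h0) // (hom_onX hB h0) // g_zeta -bi subrr.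
rewrite (hom_onB hpsi) // (hom_onX hB hpsi) // gj -bi => /eqP.
by rewrite subr_eq0.
Qed.

(** If the image of [A] under [psi0] is finite, the polynomials [q], of size bounded by [n], leave
    only finitely many possible values on [B]. *)
Lemma separation (js : seq I) n : (forall j, j \in js -> hom_on B (psi j)) ->
  (forall j a, j \in js -> A a -> psi j a = psi0 a) ->
  (forall b, B b -> exists q : {poly Omega}, [/\ q \is monic, (size q <= n)%N,
     forall i, (psi0 @` A) q`_i, root q (psi0 b) & forall j, j \in js -> root q (psi j b)]) ->
  (forall j, j \in js -> exists2 b, B b & psi j b != psi0 b) ->
  exists2 b, B b & forall j, j \in js -> psi j b != psi0 b.
Proof.
move=> hj agree intq sep.
have [inf|/existsNP [s sP]] :=
    pselect (forall s : seq Omega, exists2 a, A a & psi0 a \notin s).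
  exact: separation_infinite.
have As a : A a -> psi0 a \in s.
  by move=> Aa; apply: contrapT => /negP as_; apply: sP; exists a.
have [U UP] := bounded_degree_roots_finite s n.
apply: (@separation_finite js U) => // [b|j b jjs] /intq [q [mon_q sq Aq q0 qj]].
  by apply: (UP q) => //; [exact: monic_neq0|move=> i; have [a /As + <-] := Aq i].
by apply: (UP q) => //; [exact: monic_neq0|move=> i; have [a /As + <-] := Aq i|exact: qj].
Qed.

End Separation.

(** * Inertia *)

Lemma hom_on_horner (F Omega : fieldType) (B : set F) (psi : F -> Omega) (p : {poly F}) x :
  subring B -> hom_on B psi -> (forall i, B p`_i) -> B x ->
  psi p.[x] = (map_poly psi p).[psi x].
Proof.
move=> hB hpsi Bp Bx; have psi0 := hom_on0 hB hpsi.
rewrite horner_coef (horner_coef_wide _ (size_poly (size p) _)).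
rewrite (eq_bigr (fun i : 'I__ => psi (p`_i * x ^+ i))) => [|i _]; last first.
  rewrite (hom_onM hpsi) ?(hom_onX hB hpsi) //; last exact: subringX.
  by rewrite coef_map_id0.
have : (B (\sum_(i < size p) p`_i * x ^+ i)) /\ psi (\sum_(i < size p) p`_i * x ^+ i) =
    \sum_(i < size p) psi (p`_i * x ^+ i).
  elim/big_rec2: _ => [|i y1 y2 _ [By1 <-]]; first by split=> //; exact: subring0.
  have Bpx : B (p`_i * x ^+ i) by apply: subringM => //; exact: subringX.
  by split; [exact: subringD|rewrite (hom_onD hB hpsi)].
by case.
Qed.

Section Inertia.
Variables (S : fieldType) (L : set S) (w : valuation S).
Hypotheses (hL : subfield L) (hS : separable_closure_of L).
Implicit Types (E : set S) (s : seq S) (sigma tau : {rmorphism S -> S}).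
Local Notation O := (valuation_ring w).
Local Notation M := (valuation_ideal w).
Local Notation A := (valuation_ring w `&` L).
Local Notation C := (integral_over A : set S).

Lemma valued_subring E : subfield E -> subring (O `&` E).
Proof.
move=> hE; have rO := valuation_subring w; have rE := subfield_subring hE.
apply/subringP; split=> [|x y [Ox Ex] [Oy Ey]|x y [Ox Ex] [Oy Ey]].
- by split; exact: subring1.
- by split; exact: subringB.
- by split; exact: subringM.
Qed.

Let hO := valuation_subring w.
Let hA := valued_subring hL.
Let hC := integral_over_subring hA.

Lemma integral_valued x : C x -> O x.
Proof. by apply: integral_over_valuation => // y []. Qed.

Lemma integral_aut sigma x : galois_aut L sigma -> C x -> C (sigma x).
Proof. by move=> [_ fixL]; apply: (integral_over_aut hA _ fixL) => y []. Qed.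

Lemma integral_subring_cap E : subfield E -> subring (C `&` E).
Proof.
move=> hE; have rE := subfield_subring hE.
apply/subringP; split=> [|x y [Ox Ex] [Oy Ey]|x y [Ox Ex] [Oy Ey]].
- by split; exact: subring1.
- by split; exact: subringB.
- by split; exact: subringM.
Qed.

Lemma orbit_poly_integral E s rs rho c : L `<=` E -> galois_orbit E s rs rho -> C c ->
  orbit_poly rs rho c \is a polyOver [in C].
Proof.
move=> LE [_ hr _] Cc; rewrite /orbit_poly big_seq.
rewrite (polyOver_subringE hC); apply: rpred_prod => z zrs.
rewrite polyOverXsubC; apply/subring_predE/integral_aut => //.
exact: galois_autS LE (proj1 (hr _ zrs)).
Qed.

Section InertialStep.
Variables (E : set S) (s : seq S) (rs : seq (seq S)).
Variables (rho : seq S -> {rmorphism S -> S}) (tau : {rmorphism S -> S}).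
Hypotheses (hE : subfield E) (LE : L `<=` E) (hrs : galois_orbit E s rs rho).
Hypotheses (htau : galois_aut L tau) (inert : forall c, C c -> E c -> M (c - tau c)).

Let orbit_gal z : z \in rs -> galois_aut L (rho z).
Proof. by case: hrs => _ hr _ /hr [] /(galois_autS LE). Qed.

Let orbit_polyCE c : C c -> adjoin_field E [set` s] c ->
  forall i, (C `&` E) (orbit_poly rs rho c)`_i.
Proof.
move=> Cc Ec i; split.
  move: i; apply/(polyOver_setP _ (subring0 hC)).
  exact: (orbit_poly_integral LE hrs Cc).
move: i; apply/(polyOver_setP _ (subring0 (subfield_subring hE))).
exact: (orbit_poly_over hL hS hE LE hrs Ec).
Qed.

Let orbit_root c : adjoin_field E [set` s] c -> root (orbit_poly rs rho c) c.
Proof.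
move=> Ec; rewrite /orbit_poly (big_rem s) ?(orbit_id hrs) //=.
by rewrite rootM (orbit_aut_id hrs Ec) root_XsubC eqxx.
Qed.

(** Separation is applied to the residues of [c] and of [tau (rho z c)], which agree for integral
    [c] in [E] because [tau] is inert there. The bounded polynomial required is the residue of the
    orbit polynomial, of size [(size rs).+1]. *)
Lemma orbit_separation (js : seq (seq S)) : {subset js <= rs} ->
  (forall z, z \in js ->
     exists2 c, C c /\ adjoin_field E [set` s] c & ~ M (c - tau (rho z c))) ->
  exists2 c, C c /\ adjoin_field E [set` s] c &
    forall z, z \in js -> ~ M (c - tau (rho z c)).
Proof.
move=> js_rs sep; pose B := C `&` adjoin_field E [set` s].
have hB : subring B := integral_subring_cap (adjoin_field_subfield _ _).
have res_hom := residue_hom w.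
have homB sigma : galois_aut L sigma -> hom_on B (fun x => residue w (sigma x)).
  move=> hs; have OB x : B x -> O (sigma x) by move=> [/(integral_aut hs) /integral_valued].
  split=> [|x y Bx By|x y Bx By]; first by rewrite rmorph1 (hom_on1 res_hom).
    by rewrite rmorphB (hom_onB res_hom) //; exact: OB.
  by rewrite rmorphM (hom_onM res_hom) //; exact: OB.
have gal z : z \in rs -> galois_aut L (tau \o rho z : {rmorphism S -> S}).
  by move=> /orbit_gal; exact: galois_aut_comp.
have res_eq z c : z \in rs -> C c ->
    (residue w (tau (rho z c)) == residue w c) = `[< M (c - tau (rho z c)) >].
  move=> zrs Cc; apply/eqP/asboolP => [/esym|] h; last apply/esym.
    by apply/residue_eq => //; apply: integral_valued => //; exact: (integral_aut (gal _ zrs)).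
  by apply/residue_eq => //; apply: integral_valued => //; exact: (integral_aut (gal _ zrs)).
have [||||||b [Cb Eb] bP] := @separation S (residue_field w) (C `&` E) B (seq S)
    (residue w) (fun z c => residue w (tau (rho z c))) hB _ _ js (size rs).+1.
- by move=> c [Cc Ec]; split=> //; exact: sub_adjoin_field.
- exact: (homB _ (galois_aut_id L)).
- by move=> z /js_rs /gal /homB.
- move=> z a /js_rs zrs [Ca Ea]; apply/eqP; rewrite res_eq //; apply/asboolP.
  have [[_ fixE] _] : galois_aut E (rho z) /\ map (rho z) s = z by case: hrs => _ /(_ _ zrs).
  by rewrite fixE //; exact: inert.
- move=> b [Cb Eb]; pose Q := orbit_poly rs rho b.
  have QCE := orbit_polyCE Cb Eb; have monQ : Q \is monic by exact: monic_prod_XsubC.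
  have OQ i : O Q`_i by have [/integral_valued] := QCE i.
  have res0 := hom_on0 hO res_hom.
  have sQ : size Q = (size rs).+1 by rewrite size_prod_XsubC.
  exists (map_poly (residue w) Q).
  have lead_res : (map_poly (residue w) Q)`_(size rs) = 1.
    rewrite coef_map_id0 //; move/monicP: monQ; rewrite lead_coefE sQ /= => ->.
    exact: (hom_on1 res_hom).
  have s_res : size (map_poly (residue w) Q) = (size rs).+1.
    apply/eqP; rewrite eqn_leq -{1}sQ size_poly ltnNge /=.
    by apply/negP => /leq_sizeP /(_ _ (leqnn _)) /eqP; rewrite lead_res oner_eq0.
  split.
  + by rewrite monicE lead_coefE s_res /= lead_res.
  + by rewrite s_res.
  + by move=> i; rewrite coef_map_id0 //; exists Q`_i.
  + rewrite rootE -(hom_on_horner hO res_hom OQ) //; last exact: integral_valued.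
    by rewrite (rootP (orbit_root Eb)) res0.
  + move=> z /js_rs zrs.
    (* The coefficients of [Q] are integral elements of [E], which [tau] fixes modulo [M]; so the
       residue of [Q] also vanishes at the residue of [tau (rho z b)]. *)
    have <- : map_poly (residue w) (map_poly tau Q) = map_poly (residue w) Q.
      apply/polyP => i; rewrite !coef_map_id0 ?rmorph0 //.
      have [CQ EQ] := QCE i; apply/esym/residue_eq; [exact: OQ| |exact: inert].
      exact/integral_valued/integral_aut.
    have Oz : O (tau (rho z b)) by apply: integral_valued; exact: (integral_aut (gal _ zrs)).
    rewrite rootE -(hom_on_horner hO res_hom) //; last first.
      move=> i; rewrite coef_map; apply: integral_valued; apply: integral_aut => //.
      by have [] := QCE i.
    rewrite horner_map; have -> : Q.[rho z b] = 0; last by rewrite rmorph0 res0.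
    apply/rootP; rewrite /Q /orbit_poly (big_rem z) //=.
    by rewrite rootM root_XsubC eqxx.
- move=> z zjs; have [c [Cc Ec] cM] := sep _ zjs; exists c => //.
  by rewrite res_eq ?js_rs //; apply/asboolP.
by exists b => // z zjs; have := bP _ zjs; rewrite res_eq ?js_rs // => /asboolP.
Qed.

Lemma ideal_horner (p : {poly S}) x : (forall i, M p`_i) -> O x -> M p.[x].
Proof.
move=> Mp Ox; rewrite horner_coef; elim/big_ind: _ => [|y z|i _].
- exact: valuation_ideal0.
- exact: valuation_idealD.
- by apply: valuation_idealMr => //; exact: subringX.
Qed.

(** Otherwise a single [c] is moved modulo [M] by every [tau \o rho z]. The product of the
    differences is then a unit, but it is the value at [c] of the transport of [Q] by [tau],
    congruent to [Q.[c] = 0]. *)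
Lemma inertial_step :
  exists2 z, z \in rs & forall c, C c -> adjoin_field E [set` s] c -> M (c - tau (rho z c)).
Proof.
apply: contrapT => nz.
have [//|z zrs|c [Cc Ec] cM] := @orbit_separation rs.
  apply: contrapT => nc; apply: nz; exists z => // c Cc Ec.
  by apply: contrapT => nM; apply: nc; exists c.
pose Q := orbit_poly rs rho c; have QCE := orbit_polyCE Cc Ec.
have Oc := integral_valued Cc.
have : M (map_poly tau Q).[c].
  have -> : (map_poly tau Q).[c] = - (Q - map_poly tau Q).[c].
    by rewrite hornerD hornerN (rootP (orbit_root Ec)) sub0r opprK.
  rewrite -sub0r; apply: valuation_idealB; first exact: valuation_ideal0.
  apply: ideal_horner => // i; have [CQ EQ] := QCE i.
  by rewrite coefB coef_map; exact: inert.
have -> : (map_poly tau Q).[c] = \prod_(z <- rs) (c - tau (rho z c)).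
  rewrite rmorph_prod horner_prod; apply: eq_bigr => z _.
  by rewrite rmorphB /= map_polyX map_polyC hornerXsubC.
have Ofac z : z \in rs -> O (c - tau (rho z c)).
  move=> zrs; apply: (subringB hO) => //; apply: integral_valued.
  by apply: integral_aut => //; apply: integral_aut => //; exact: orbit_gal.
have [|_] := @valuation_prod_unit _ w _ rs (fun z => c - tau (rho z c)); last by [].
by move=> z zrs; split; [exact: Ofac|exact: cM].
Qed.

End InertialStep.

Lemma inertia_extend E sigma0 : subfield E -> L `<=` E -> galois_aut L sigma0 ->
  (forall c, C c -> E c -> M (c - sigma0 c)) ->
  exists sigma, [/\ galois_aut L sigma, forall x, E x -> sigma x = sigma0 x &
    forall c, C c -> (M `&` C) (c - sigma c)].
Proof.
move=> hE LE hs0 inert0.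
have aut_graph (X : set S) (sigma : {rmorphism S -> S}) : subfield X ->
    field_graph [set (x, sigma x) | x in X].
  move=> hX; have rX := subfield_subring hX.
  apply: field_graphP => [|a b c d [x Xx [<- <-]] [z Xz [<- <-]]|
    a b c d [x Xx [<- <-]] [z Xz [<- <-]]|a b [x _ [<- <-]]].
  - by exists 1; rewrite ?rmorph1 //; exact: (subring1 rX).
  - by exists (x - z); rewrite ?rmorphB //; exact: (subringB rX).
  - by exists (x / z); rewrite ?fmorph_div //; apply: (subringM rX) => //; exact: (subfieldV hX).
  - by rewrite fmorph_eq0.
pose Phi := [set q : S * S | C q.1 -> M (q.1 - q.2)].
have [||g y hg Eg gPhi|sigma [sg sPhi]] :=
    @graph_extend_total S Phi [set (x, sigma0 x) | x in E].
- exact: aut_graph.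
- by move=> _ [x Ex <-] /= Cx; exact: inert0.
- pose X := [set x | exists x', g (x, x')].
  have Lg x : L x -> g (x, x).
    by move=> Lx; apply: Eg; exists x; [exact: LE|rewrite hs0.2].
  have LX : L `<=` X by move=> x /Lg gx; exists x.
  have hX : subfield X.
    apply/subfieldP; split=> [|x z [x' gx] [z' gz]|x z [x' gx] [z' gz]].
    + by exists 1; exact: (graph1 hg).
    + by exists (x' - z'); exact: (graphB hg).
    + by exists (x' / z'); exact: (graph_div hg).
  (* [tau] extends [g] without regard to inertia; composing it with an automorphism [rho z] over the
     domain [X] restores inertia on the field generated by [y]. *)
  have [tau htau tg] := graph_automorphism hL hS hg Lg.
  have inert c : C c -> X c -> M (c - tau c).
    by move=> Cc [c' gc]; rewrite (tg _ _ gc); exact: (gPhi _ gc).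
  have [rs [rho hrs]] := galois_orbit_exists [:: y] LX (subring0 (subfield_subring hX))
    (separable_closure_algebraic hS).
  have [z zrs zP] := inertial_step hX LX hrs htau inert.
  exists [set (x, tau (rho z x)) | x in adjoin_field X [set` [:: y]]]; split.
  + exact: (aut_graph _ (tau \o rho z : {rmorphism S -> S}) (adjoin_field_subfield _ _)).
  + move=> [x x'] gx; exists x; first by apply: sub_adjoin_field; exists x'.
    have [[_ fixX] _] : galois_aut X (rho z) /\ map (rho z) [:: y] = z by case: hrs => _ /(_ _ zrs).
    by rewrite fixX ?(tg _ _ gx) //; exists x'.
  + by move=> _ [x Xx <-] /= Cx; exact: zP.
  + exists (tau (rho z y)), y => //; apply: gen_adjoin_field.
    by rewrite /= mem_head.
have fixL x : L x -> sigma x = x.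
  move=> Lx; rewrite (sg x (sigma0 x)) ?hs0.2 //.
  by exists x; [exact: LE|rewrite hs0.2].
have hs : galois_aut L sigma.
  split=> //; apply: (fixing_bijective _ (separable_closure_algebraic hS) fixL).
  exact: (subring0 (subfield_subring hL)).
exists sigma; split=> // [x Ex|c Cc]; first by apply: sg; exists x.
split; first exact: sPhi.
by apply: (subringB hC) => //; exact: integral_aut.
Qed.

End Inertia.

(** * Fractions of integral elements and the etale generator *)

Lemma horner_drop_poly (R : nzRingType) (p : {poly R}) k z :
  (drop_poly k p).[z] = p`_k + (drop_poly k.+1 p).[z] * z.
Proof.
have -> : drop_poly k p = (p`_k)%:P + drop_poly k.+1 p * 'X.
  apply/polyP => -[|i]; rewrite coefD coefC coefMX !coef_drop_poly /= ?addr0 //.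
  by rewrite add0r addnS addSn.
by rewrite hornerD hornerC hornerMX.
Qed.

Section EtaleGenerator.
Variables (S : fieldType) (L : set S) (w : valuation S).
Hypotheses (hL : subfield L).
Local Notation O := (valuation_ring w).
Local Notation M := (valuation_ideal w).
Local Notation A := (valuation_ring w `&` L).
Local Notation C := (integral_over A : set S).

Let hO := valuation_subring w.
Let hA := valued_subring w hL.
Let hC := integral_over_subring hA.
Let rL := subfield_subring hL.

Lemma primitive_annihilator z : algebraic_over L z ->
  exists p : {poly S}, [/\ forall i, A p`_i, root p z & exists i, ~ M p`_i].
Proof.
move=> [p [/(polyOver_setP _ (subring0 rL)) Lp p0 pz]].
have [|e [/(nthP 0) [k sk ek] e0 eO]] := @valuation_min_seq _ w (p : seq S).
  apply/hasP; exists (lead_coef p); last by rewrite lead_coef_eq0.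
  by rewrite lead_coefE mem_nth // prednK // size_poly_gt0.
exists (e^-1 *: p); split=> [i||].
- rewrite coefZ mulrC; split; last first.
    by apply: (subringM rL) => //; apply: (subfieldV hL); rewrite -ek.
  have [si|si] := ltnP i (size p); first by apply: eO; exact: mem_nth.
  by rewrite nth_default // mul0r; exact: subring0.
- by rewrite rootZ ?invr_eq0.
- by exists k; rewrite coefZ ek mulVf //; exact: valuation_ideal1.
Qed.

(* With [p = \sum_i a_i 'X^i], the element [u_k = a_k + a_(k+1) z + ...] satisfies
   [u_k z^k + \sum_(i < k) a_i z^i = 0]: if [u_k] is integral, so is [u_k z]. *)
Lemma integral_partial_horner (p : {poly S}) z k : (forall i, A p`_i) -> root p z ->
  C (drop_poly k p).[z] /\ C (z * (drop_poly k p).[z]).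
Proof.
move=> Ap pz; have [sk|ks] := leqP (size p) k.
  by rewrite drop_poly_eq0 // horner0 mulr0; split; exact: subring0.
have step j : C (drop_poly j p).[z] -> C (z * (drop_poly j p).[z]).
  case: j => [|j]; first by rewrite drop_poly0l (rootP pz) mulr0 => _; exact: subring0.
  set u := _.[z] => Cu.
  (* Multiplied by [u ^+ j], the relation for [k = j.+1] becomes the monic equation [q] for [z * u],
     whose coefficients are integral. *)
  pose r := \poly_(i < j.+1) (p`_i * u ^+ (j - i)).
  pose q : {poly S} := 'X^(j.+1) + r.
  have lt_q : (size r < size ('X^(j.+1) : {poly S}))%N.
    by rewrite size_polyXn ltnS size_poly.
  apply: (@integral_over_trans _ _ hA q).
  - by rewrite monicE lead_coefDl // lead_coefXn.
  - rewrite rootE hornerD hornerXn horner_poly.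
    have -> : \sum_(i < j.+1) p`_i * u ^+ (j - i) * (z * u) ^+ i =
        u ^+ j * (take_poly j.+1 p).[z].
      rewrite horner_poly mulr_sumr; apply: eq_bigr => i _.
      have ij : (i <= j)%N by rewrite -ltnS.
      have -> : u ^+ j = u ^+ (j - i) * u ^+ i by rewrite -exprD subnK.
      by rewrite exprMn; ring.
    have := rootP pz; rewrite -{1}(poly_take_drop j.+1 p) hornerD hornerM hornerXn -/u.
    move/(congr1 (fun y => u ^+ j * y)); rewrite mulr0 mulrDr addrC => <-.
    by rewrite exprMn [in u ^+ j.+1]exprSr; apply/eqP; congr (_ + _); ring.
  - move=> i; rewrite coefD coefXn coef_poly; apply: (subringD hC).
      by case: eqP => _; [exact: subring1|exact: subring0].
    case: ifP => _; last exact: subring0.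
    by apply: (subringM hC); [exact: integral_over_id|exact: (subringX hC)].
(* Descending induction from the zero value at [k = size p], by [u_k = a_k + z u_(k+1)]. *)
have all_k n : (n <= size p)%N -> C (drop_poly (size p - n) p).[z].
  elim: n => [_|n IHn sn].
    by rewrite subn0 drop_poly_eq0 // horner0; exact: subring0.
  rewrite horner_drop_poly -subSn // subSS mulrC.
  apply: (subringD hC); first exact: integral_over_id.
  exact/step/IHn/ltnW.
have Ck : C (drop_poly k p).[z] by rewrite -(subKn (ltnW ks)); apply: all_k; exact: leq_subr.
by split=> //; exact: step.
Qed.

Lemma integral_fraction z : O z -> algebraic_over L z ->
  exists q : {poly S}, [/\ q \is a polyOver [in L], C q.[z], C (z * q.[z]) & ~ M q.[z]].
Proof.
move=> Oz /primitive_annihilator [p [Ap pz [i0 Mi0]]].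
have [k [Mk kmax]] : exists k, ~ M p`_k /\ forall i, (k < i)%N -> M p`_i.
  have ub i : `[< ~ M p`_i >] -> (i <= size p)%N.
    move=> /asboolP Mi; rewrite leqNgt; apply/negP => si; apply: Mi.
    have -> : p`_i = 0 by rewrite nth_default // ltnW.
    exact: valuation_ideal0.
  have ex : exists i, `[< ~ M p`_i >] by exists i0; apply/asboolP.
  case: (ex_maxnP ex ub) => k /asboolP Mk kmax; exists k; split=> // i ki.
  apply: contrapT => Mi; have := kmax i; rewrite leqNgt ki => h.
  by suff : false by []; apply: h; apply/asboolP.
have [Cu Czu] := integral_partial_horner k Ap pz.
exists (drop_poly k p); split=> //.
  apply/(polyOver_setP _ (subring0 rL)) => i; rewrite coef_drop_poly.
  by have [] := Ap (i + k)%N.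
rewrite horner_drop_poly => Mu; apply: Mk.
rewrite -[p`_k](addrK ((drop_poly k.+1 p).[z] * z)); apply: valuation_idealB => //.
apply: valuation_idealMr => //; apply: ideal_horner => // i.
by rewrite coef_drop_poly; apply: kmax; rewrite addnS ltnS leq_addl.
Qed.

End EtaleGenerator.

Section EtaleGeneratorExists.
Variables (S : fieldType) (L : set S) (w : valuation S) (s : seq S).
Hypotheses (hL : subfield L) (hS : separable_closure_of L).
Local Notation O := (valuation_ring w).
Local Notation M := (valuation_ideal w).
Local Notation A := (valuation_ring w `&` L).
Local Notation C := (integral_over A : set S).
Local Notation K1 := (adjoin_field L [set` s]).

Let hO := valuation_subring w.
Let hA := valued_subring w hL.
Let hC := integral_over_subring hA.
Let rL := subfield_subring hL.
Let L0 := subring0 rL.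
Let hK1 : subfield K1 := adjoin_field_subfield _ _.

Lemma inertia_field_moved rs rho z : galois_orbit L s rs rho -> z \in rs -> z != s ->
  K1 `<=` absolute_inertia_field L w ->
  exists2 c, C c /\ K1 c & ~ M (c - rho z c).
Proof.
move=> hrs zrs zs inK1; apply: contrapT => nc.
have [hz mz] : galois_aut L (rho z) /\ map (rho z) s = z by case: hrs => _ /(_ _ zrs).
have [|c Cc Kc|sigma [hs sz sM]] := inertia_extend hL hS hK1 _ hz (w := w).
- exact: sub_adjoin_field.
- by apply: contrapT => cM; apply: nc; exists c.
case/eqP: zs; rewrite -mz -[RHS]map_id; apply/eq_in_map => x xs.
have Kx : K1 x by exact: gen_adjoin_field.
by rewrite -sz //; apply: (inK1 _ Kx); split.
Qed.

Lemma etale_generator : K1 `<=` absolute_inertia_field L w ->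
  exists x f, [/\ C x /\ K1 x, f \is monic /\ f \is a polyOver [in A],
    root f x /\ ~ M f^`().[x],
    forall h, h \is a polyOver [in L] -> h != 0 -> root h x -> (size f <= size h)%N &
    forall c, C c -> K1 c ->
      exists2 g, g \is a polyOver [in A] & f^`().[x] * c = g.[x]].
Proof.
move=> inK1; have algL := separable_closure_algebraic hS.
have [rs [rho hrs]] := galois_orbit_exists s (@subset_refl _ L) L0 algL.
have srs := orbit_id hrs; have urs : uniq rs by case: hrs.
have LL := @subset_refl _ L.
have sub_js : {subset rem s rs <= rs} by exact: mem_rem.
have js_s z : z \in rem s rs -> z != s.
  by rewrite mem_rem_uniq // inE => /andP [].
have gal z : z \in rs -> galois_aut L (rho z) by case: hrs => _ hr _ /hr [].
(* Separation with [tau] the identity and the trivial embedding [s] removed from the orbit. *)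
have [c _ _|z zjs|x [Cx Kx] xM] := orbit_separation hL hS hL LL hrs (galois_aut_id L)
    (w := w) _ sub_js.
- by rewrite subrr; exact: valuation_ideal0.
- have [c [Cc Kc] cM] := inertia_field_moved hrs (sub_js _ zjs) (js_s _ zjs) inK1.
  by exists c.
have Cz z : z \in rs -> C (rho z x) by move=> /gal hz; exact: (integral_aut hL hz).
have OC := integral_valued hL (w := w).
pose f := orbit_poly rs rho x; pose q z := \prod_(t <- rem z rs) ('X - (rho t x)%:P).
have fq z : z \in rs -> f = ('X - (rho z x)%:P) * q z.
  by move=> zrs; rewrite /f /orbit_poly (big_rem z).
have Lf : f \is a polyOver [in L] by exact: (orbit_poly_over hL hS hL LL hrs).
have mon_f : f \is monic by exact: monic_prod_XsubC.
have Af : f \is a polyOver [in A].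
  apply/(polyOver_setP _ (subring0 hA)) => i; split.
    apply: OC; move: i; apply/(polyOver_setP _ (subring0 hC)).
    exact: (orbit_poly_integral hL LL hrs).
  by move: i; apply/(polyOver_setP _ L0).
have xs : rho s x = x by exact: (orbit_aut_id hrs).
have df : f^`().[x] = (q s).[x].
  by rewrite (fq s) // xs derivM derivXsubC mul1r hornerD hornerM hornerXsubC subrr mul0r addr0.
have qx : O (q s).[x] /\ ~ M (q s).[x].
  rewrite horner_prod; apply: valuation_prod_unit => z zjs; rewrite hornerXsubC.
  split; last exact: xM.
  by apply: (subringB hO); apply: OC => //; apply/Cz/sub_js.
exists x, f; split=> //.
- by rewrite df; split; [rewrite (fq s) // rootM xs root_XsubC eqxx|exact: qx.2].
- move=> h Lh h0 hx; rewrite size_prod_XsubC -(size_map (rho^~ x)).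
  apply: max_poly_roots => //.
    apply/allP => _ /mapP [z zrs ->].
    rewrite -(map_poly_fixed L0 (gal _ zrs).2 Lh) rootE horner_map.
    by rewrite (rootP hx) rmorph0.
  rewrite map_inj_in_uniq // => z z' zrs z'rs ezz'.
  (* Distinct embeddings give distinct conjugates of [x]: pulling an equality back by the inverse of
     [rho z] makes some conjugate equal to [x], which [xM] allows only for the index [s]. *)
  have [tau htau [tz zt]] := galois_aut_inv (gal _ zrs).
  have := congr1 tau ezz'; rewrite tz (orbit_aut hrs) // => e.
  have [ts|ts] := eqVneq (map tau z') s.
    have mz : map (rho z) s = z by case: hrs => _ /(_ _ zrs) [].
    by rewrite -mz -ts -map_comp map_id_in // => a _; exact: zt.
  have : map tau z' \in rem s rs by rewrite mem_rem_uniq // inE ts (orbit_stable hrs).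
  by move=> /xM; rewrite /= -e subrr; case; exact: valuation_ideal0.
- move=> c Cc Kc.
  (* As a quotient of [f], the cofactor depends on [z] only through [rho z x], which makes its
     equivariance visible. *)
  have qE z : z \in rs -> q z = f %/ ('X - (rho z x)%:P).
    by move=> zrs; rewrite (fq z) // mulKp // polyXsubC_eq0.
  pose g := \sum_(z <- rs) rho z c *: (f %/ ('X - (rho z x)%:P)).
  have Lg : g \is a polyOver [in L].
    apply: (orbit_sum_over hL hS hL LL hrs) => sigma z hs zrs.
    rewrite map_polyZ map_divp rmorphB /= map_polyX map_polyC /=.
    by rewrite !(orbit_aut hrs) // (map_poly_fixed L0 hs.2 Lf).
  have gE : g = \sum_(z <- rs) rho z c *: q z.
    by apply: eq_big_seq => z zrs; rewrite qE.
  exists g.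
    apply/(polyOver_setP _ (subring0 hA)) => i; split; last by move: i; apply/(polyOver_setP _ L0).
    apply: OC; move: i; apply/(polyOver_setP _ (subring0 hC)).
    rewrite gE big_seq (polyOver_subringE hC); apply: rpred_sum => z zrs.
    apply: polyOverZ; first by apply/subring_predE; exact: (integral_aut hL (gal _ zrs)).
    rewrite /q big_seq; apply: rpred_prod => t /mem_rem trs.
    by rewrite polyOverXsubC; apply/subring_predE/Cz.
  rewrite gE horner_sum (big_rem s) //= big_seq big1 => [|z zjs].
    by rewrite addr0 hornerZ (orbit_aut_id hrs) // df mulrC.
  rewrite hornerZ; have -> : (q z).[x] = 0; last by rewrite mulr0.
  apply/rootP; rewrite /q (big_rem s) /=; first by rewrite rootM xs root_XsubC eqxx.
  by rewrite mem_rem_uniq // inE eq_sym js_s.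
Qed.

Lemma etale_presentation : K1 `<=` absolute_inertia_field L w ->
  exists x f, [/\ O x /\ K1 x, f \is monic /\ f \is a polyOver [in A],
    root f x /\ ~ M f^`().[x],
    forall h, h \is a polyOver [in L] -> h != 0 -> root h x -> (size f <= size h)%N &
    forall z, O z -> K1 z -> exists g h, [/\ g \is a polyOver [in A],
      h \is a polyOver [in A], ~ M h.[x] & z = g.[x] / h.[x]]].
Proof.
move=> /etale_generator [x [f [[Cx Kx] [mon_f Af] [fx dfx] fmin fP]]].
have OC := integral_valued hL (w := w).
exists x, f; split=> //; first by split=> //; exact: OC.
move=> z Oz Kz.
have [q [Lq Cd Czd Md]] := integral_fraction hL Oz (separable_closure_algebraic hS z).
have Kd : K1 q.[z].
  apply/(subfield_predE hK1); apply: rpred_horner; last exact/subfield_predE.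
  apply/allP => a aq; apply/(subfield_predE hK1); apply: sub_adjoin_field.
  by move/allP: Lq => /(_ _ aq); rewrite inE.
have [h Ah hE] := fP _ Cd Kd.
have Kzd : K1 (z * q.[z]) by apply: (subringM (subfield_subring hK1)).
have [g Ag gE] := fP _ Czd Kzd.
have Odf : O f^`().[x].
  apply/(subring_predE hO); apply: rpred_horner; last exact/subring_predE/OC.
  apply: polyOver_deriv; apply/allP => a af; apply/(subring_predE hO).
  by move/allP: Af => /(_ _ af); rewrite inE => -[].
exists g, h; split=> //.
  by rewrite -hE => /(valuation_prime Odf (OC _ Cd)) [].
rewrite -gE -hE invfM mulrACA divff ?mul1r ?mulfK //.
  exact: (valuation_nideal_neq0 Md).
exact: (valuation_nideal_neq0 dfx).
Qed.

End EtaleGeneratorExists.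

(** * Etale extensions of regular local rings *)

Section Ideals.
Variables (F : fieldType) (A : set F).
Hypothesis hA : subring A.
Implicit Types I P N : set F.

Definition submodule N :=
  [/\ N 0, forall x y, N x -> N y -> N (x + y) & forall a x, A a -> N x -> N (a * x)].

Lemma submoduleB N x y : submodule N -> N x -> N y -> N (x - y).
Proof.
move=> [N0 ND NM] Nx Ny; apply: ND => //; rewrite -mulN1r; apply: NM => //.
by apply: subringN => //; exact: subring1.
Qed.

Lemma ideal_gen_ideal (s : seq F) : [set` s] `<=` A -> ideal A (ideal_gen A s).
Proof.
move=> sA; have idA : ideal A A.
  by split=> // [|x y|a x]; [exact: subring0|exact: subringD|exact: subringM].
split=> [x|I [[_ I0 _ _]]|x y gx gy I IP|a x Aa gx I IP] //.
- exact.
- by have [[_ _ ID _] _] := IP; apply: ID; [exact: gx|exact: gy].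
- by have [[_ _ _ IM] _] := IP; apply: IM => //; exact: gx.
Qed.

Lemma ideal_gen_mem I s : ideal A I -> [set` s] `<=` I -> ideal_gen A s `<=` I.
Proof. by move=> hI sI; exact: smallest_sub. Qed.

Lemma gen_ideal_gen s : [set` s] `<=` ideal_gen A s.
Proof. by move=> x xs I [_]; apply. Qed.

End Ideals.

Section LocalSubring.
Variables (F : fieldType) (v : valuation F) (A : set F).
Local Notation O := (valuation_ring v).
Local Notation M := (valuation_ideal v).
Hypotheses (hA : subring A) (AO : A `<=` O) (unitA : forall a, A a -> ~ M a -> A a^-1).

Lemma proper_ideal_center I : Defs.proper_ideal A I -> I `<=` A `&` M.
Proof.
move=> [[IA _ _ IM] I1] a Ia; split; first exact: IA.
apply: contrapT => Ma; apply: I1.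
rewrite -(mulVf (valuation_nideal_neq0 Ma)).
by apply: IM => //; apply: unitA => //; exact: IA.
Qed.

Lemma center_proper_ideal : Defs.proper_ideal A (A `&` M).
Proof.
split; last by case=> _ /valuation_ideal1.
split=> [x [] //||x y [Ax Mx] [Ay My]|a x Aa [Ax Mx]].
- by split; [exact: subring0|exact: valuation_ideal0].
- by split; [exact: subringD|exact: valuation_idealD].
- by split; [exact: subringM|apply: valuation_idealMl => //; exact: AO].
Qed.

Lemma center_prime_ideal : prime_ideal A (A `&` M).
Proof.
split; first exact: center_proper_ideal.
move=> x y Ax Ay [_ /(valuation_prime (AO Ax) (AO Ay)) []] h; [left|right]; by split.
Qed.

Lemma local_ring_center : local_ring A (A `&` M).
Proof.
move=> I; split=> [[pI maxI]|->].
  by rewrite (maxI _ center_proper_ideal) //; exact: proper_ideal_center.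
split; first exact: center_proper_ideal.
by move=> J pJ sub; apply/seteqP; split=> //; exact: proper_ideal_center.
Qed.

End LocalSubring.

Section EtaleAscent.
Variables (F : fieldType) (v : valuation F) (A : set F) (x : F) (f : {poly F}).
Local Notation O := (valuation_ring v).
Local Notation M := (valuation_ideal v).
Hypotheses (hA : subring A) (AO : A `<=` O) (unitA : forall a, A a -> ~ M a -> A a^-1).
Hypotheses (Ox : O x) (mon_f : f \is monic) (Af : forall i, A f`_i) (fx : root f x).
Hypothesis dfx : ~ M f^`().[x].

Let hO := valuation_subring v.

(** The localization of [A[x]] at the center of [v], with elements of [A[x]] given as values of
    polynomials. *)
Definition etale_local : set F := [set y | exists g h : {poly F},
  [/\ forall i, A g`_i, forall i, A h`_i, ~ M h.[x] & y = g.[x] / h.[x]]].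
Local Notation B := etale_local.

Definition coefs_in (N : set F) (p : {poly F}) := forall i, N p`_i.

Lemma coefs_inE p : coefs_in A p <-> p \is a polyOver (subring_pred hA).
Proof. by rewrite -polyOver_subringE; apply: iff_sym; apply: polyOver_setP; exact: subring0. Qed.

Lemma coefs_inM p q : coefs_in A p -> coefs_in A q -> coefs_in A (p * q).
Proof. by move=> /coefs_inE Ap /coefs_inE Aq; apply/coefs_inE/rpredM. Qed.
Lemma coefs_inD p q : coefs_in A p -> coefs_in A q -> coefs_in A (p + q).
Proof. by move=> /coefs_inE Ap /coefs_inE Aq; apply/coefs_inE/rpredD. Qed.
Lemma coefs_inB p q : coefs_in A p -> coefs_in A q -> coefs_in A (p - q).
Proof. by move=> /coefs_inE Ap /coefs_inE Aq; apply/coefs_inE/rpredB. Qed.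
Lemma coefs_inC a : A a -> coefs_in A a%:P.
Proof. by move=> /(subring_predE hA) Aa; apply/coefs_inE; rewrite polyOverC. Qed.
Lemma coefs_inXn n : coefs_in A 'X^n.
Proof. by apply/coefs_inE; rewrite rpredX // polyOverX. Qed.

Lemma coefs_in_horner p : coefs_in A p -> O p.[x].
Proof.
move=> Ap; apply/(subring_predE hO); apply: rpred_horner; last exact/subring_predE.
apply/(@polyOver_setP F O _ (subring0 hO)) => i; exact: AO.
Qed.

Lemma etale_local_unit_poly g h : coefs_in A g -> coefs_in A h -> ~ M g.[x] -> ~ M h.[x] ->
  coefs_in A (g * h) /\ ~ M (g * h).[x].
Proof.
move=> Ag Ah Mg Mh; split; first exact: coefs_inM.
rewrite hornerM => /(valuation_prime (coefs_in_horner Ag) (coefs_in_horner Ah)).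
by case.
Qed.

Lemma etale_local_horner g : coefs_in A g -> B g.[x].
Proof.
move=> Ag; exists g, 1%:P; split=> //; rewrite ?hornerC ?divr1 //.
  by apply: coefs_inC; exact: subring1.
exact: valuation_ideal1.
Qed.

Lemma sub_etale_local : A `<=` B.
Proof. by move=> a Aa; rewrite -(hornerC a x); apply/etale_local_horner/coefs_inC. Qed.

Lemma etale_local_subring : subring B.
Proof.
apply/subringP; split=> [|y z|y z].
- by apply: sub_etale_local; exact: subring1.
- move=> [g [h [Ag Ah Mh ->]]] [g' [h' [Ag' Ah' Mh' ->]]].
  have [Ahh' Mhh'] := etale_local_unit_poly Ah Ah' Mh Mh'.
  exists (g * h' - g' * h), (h * h'); split=> //.
    by apply: coefs_inB; exact: coefs_inM.
  rewrite !(hornerD, hornerN, hornerM) -mulNr.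
  rewrite addf_div ?mulNr //; exact: (@valuation_nideal_neq0 _ v).
- move=> [g [h [Ag Ah Mh ->]]] [g' [h' [Ag' Ah' Mh' ->]]].
  have [Ahh' Mhh'] := etale_local_unit_poly Ah Ah' Mh Mh'.
  exists (g * g'), (h * h'); split=> //; first exact: coefs_inM.
  by rewrite !hornerM mulf_div.
Qed.

Lemma etale_local_valued : B `<=` O.
Proof.
move=> _ [g [h [Ag Ah Mh ->]]]; apply: (subringM hO); first exact: coefs_in_horner.
by apply: valuation_unit => //; exact: coefs_in_horner.
Qed.

Lemma etale_local_center g h : coefs_in A g -> coefs_in A h -> ~ M h.[x] ->
  M (g.[x] / h.[x]) <-> M g.[x].
Proof.
move=> Ag Ah Mh; have Oh := coefs_in_horner Ah; split=> Mg; last first.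
  by apply: valuation_idealMr => //; exact: valuation_unit.
rewrite -[g.[x]](divfK (valuation_nideal_neq0 Mh)).
exact: valuation_idealMr.
Qed.

Lemma etale_local_unit b : B b -> ~ M b -> B b^-1.
Proof.
move=> [g [h [Ag Ah Mh ->]]] Mb; exists h, g; split=> //; last by rewrite invf_div.
by move=> Mg; apply: Mb; apply/etale_local_center.
Qed.

Let hB := etale_local_subring.
Let unitB := etale_local_unit.

Lemma size_modulus_gt0 : (0 < size f)%N.
Proof. by rewrite size_poly_gt0 monic_neq0. Qed.

(** Division by the monic [f] only subtracts multiples of coefficients already in [N], so the
    remainder keeps its coefficients there. It serves for [A] itself and for a prime ideal. *)
Lemma coefs_reduce N h : submodule A N -> coefs_in N h ->
  exists h', [/\ coefs_in N h', (size h' < size f)%N & h'.[x] = h.[x]].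
Proof.
move=> hN; elim: {h}(size h) {-2}h (leqnn (size h)) => [|n IHn] h sh Nh.
  exists h; split=> //; move: sh; rewrite leqn0 => /eqP ->; exact: size_modulus_gt0.
have [lt_hf|le_fh] := ltnP (size h) (size f); first by exists h.
pose k := (size h - size f)%N; pose h1 := h - lead_coef h *: (f * 'X^k).
have h0 : h != 0 by rewrite -size_poly_gt0 (leq_trans size_modulus_gt0).
have fX : size (f * 'X^k) = size h.
  by rewrite size_Mmonic ?monic_neq0 ?monicXn // size_polyXn addnS /= subnKC.
have lfX : lead_coef (f * 'X^k) = 1.
  by rewrite lead_coef_Mmonic ?monicXn //; exact/monicP.
have [|i|h' [Nh' sh' h'x]] := IHn h1.
- rewrite -ltnS (leq_trans _ sh) // ltn_neqAle; apply/andP; split; last first.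
    rewrite (leq_trans (size_polyD _ _)) // geq_max leqnn size_polyN.
    by rewrite (leq_trans (size_scale_leq _ _)) ?fX.
  apply/eqP => s1; have : lead_coef h1 = 0.
    rewrite lead_coefE s1 coefB coefZ -lead_coefE.
    by rewrite -[in X in _ - _ * X]fX -lead_coefE lfX mulr1 subrr.
  move/eqP; rewrite lead_coef_eq0 -size_poly_eq0 s1 size_poly_eq0.
  by rewrite (negPf h0).
- rewrite coefB coefZ mulrC; apply: (submoduleB hA hN) => //.
  case: hN => _ _; apply; last by rewrite lead_coefE.
  by apply: coefs_inM => //; exact: coefs_inXn.
exists h'; split=> //; rewrite h'x hornerD hornerN hornerZ hornerM (rootP fx).
by rewrite mul0r mulr0 subr0.
Qed.

Lemma submodule_self : submodule A A.
Proof. by split; [exact: subring0|exact: subringD|exact: subringM]. Qed.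

Lemma coefs_in_sub p : coefs_in (A `&` M) p -> coefs_in A p.
Proof. by move=> h i; have [] := h i. Qed.

(* The kernel of [A[X] -> O / M, h |-> h(x)] is generated by [A `&` M] and a monic
   polynomial [g] that divides [f] exactly once modulo [A `&` M]. *)
Lemma etale_local_maximal (J : set F) : ideal B J -> A `&` M `<=` J -> B `&` M `<=` J.
Proof.
move=> [JB J0 JD JM] mJ.
pose Q n := `[< exists g : {poly F}, [/\ coefs_in A g, g \is monic, M g.[x] & size g = n] >].
have exQ : exists n, Q n.
  exists (size f); apply/asboolP; exists f; split=> //.
  by rewrite (rootP fx); exact: valuation_ideal0.
case: (ex_minnP exQ) => _ /asboolP [g [Ag mon_g Mg <-]] min_g.
have g0 : (0 < size g)%N by rewrite size_poly_gt0 monic_neq0.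
(* Division by [g] with a remainder whose coefficients are in [M], one leading term at a time. *)
have divg h : coefs_in A h -> M h.[x] ->
    exists u r, [/\ coefs_in A u, coefs_in (A `&` M) r & h = g * u + r].
  elim: {h}(size h) {-2}h (leqnn (size h)) => [|n IHn] h sh Ah Mh;
      have [->|h0] := eqVneq h 0.
  - by exists 0, 0; rewrite mulr0 addr0; split=> // i; rewrite coef0;
      [exact: subring0|split; [exact: subring0|exact: valuation_ideal0]].
  - by move: sh; rewrite leqn0 size_poly_eq0 (negPf h0).
  - by exists 0, 0; rewrite mulr0 addr0; split=> // i; rewrite coef0;
      [exact: subring0|split; [exact: subring0|exact: valuation_ideal0]].
  set a := lead_coef h; have Aa : A a by rewrite /a lead_coefE.
  have [k sk] : exists k, size h = k.+1.
    by exists (size h).-1; rewrite prednK // size_poly_gt0.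
  have reduce p : coefs_in A p -> M p.[x] -> size p = k.+1 -> lead_coef p = a ->
      exists u r, [/\ coefs_in A u, coefs_in (A `&` M) r & h - p = g * u + r].
    move=> Ap Mp sp lp; apply: IHn; last 2 first.
    - exact: coefs_inB.
    - by rewrite hornerD hornerN; exact: valuation_idealB.
    rewrite -ltnS (leq_trans _ sh) // ltn_neqAle; apply/andP; split; last first.
      by rewrite (leq_trans (size_polyD _ _)) // geq_max leqnn size_polyN sp sk /=.
    apply/eqP => s1; have : lead_coef (h - p) = 0.
      rewrite lead_coefE s1 coefB -lead_coefE sk -sp -lead_coefE lp.
      by rewrite subrr.
    by move/eqP; rewrite lead_coef_eq0 -size_poly_eq0 s1 size_poly_eq0 (negPf h0).
  (* A leading term with coefficient in [M] goes into the remainder. *)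
  have [Ma|Ma] := pselect (M a).
    have aXk i : (A `&` M) (a *: 'X^k)`_i.
      rewrite coefZ coefXn; case: eqP => _; rewrite ?mulr1 // mulr0.
      by split; [exact: subring0|exact: valuation_ideal0].
    have [||||u [r [Au mr hE]]] := reduce (a *: 'X^k).
    - exact: coefs_in_sub.
    - by rewrite hornerZ hornerXn; apply: valuation_idealMr => //; exact: (subringX hO).
    - by rewrite size_scale ?size_polyXn // lead_coef_eq0.
    - by rewrite lead_coefZ lead_coefXn mulr1.
    exists u, (r + a *: 'X^k); split=> [//|i|]; last by rewrite addrA -hE subrK.
    have [_ _ mD _] := (center_proper_ideal hA AO).1.
    by rewrite coefD; exact: mD.
  have a0 := valuation_nideal_neq0 Ma; have AVa := unitA Aa Ma.
  (* Divided by its unit leading coefficient, [h] competes with [g], whose degree is minimal. *)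
  have sg : (size g <= k.+1)%N.
    rewrite -sk -(size_scale h (invr_neq0 a0)); apply: min_g; apply/asboolP.
    exists (a^-1 *: h); split=> [i||//|//].
    - by rewrite coefZ; exact: subringM.
    - by rewrite monicE lead_coefZ mulVf.
    - by rewrite hornerZ; apply: valuation_idealMl => //; exact: AO.
  pose m := (k.+1 - size g)%N.
  have AaX : coefs_in A (a%:P * 'X^m) by apply: coefs_inM; [exact: coefs_inC|exact: coefs_inXn].
  have [||||u [r [Au mr hE]]] := reduce (g * (a%:P * 'X^m)).
  - exact: coefs_inM.
  - by rewrite hornerM; apply: valuation_idealMr => //; exact: coefs_in_horner.
  - rewrite size_monicM //; last by rewrite mulf_neq0 ?polyC_eq0 ?monic_neq0 ?monicXn.
    by rewrite mul_polyC size_scale // size_polyXn addnS /= subnKC.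
  - by rewrite lead_coef_monicM // mul_polyC lead_coefZ lead_coefXn mulr1.
  exists (u + a%:P * 'X^m), r; split=> //; first exact: coefs_inD.
  by rewrite mulrDr addrAC -hE subrK.
have Jm r : coefs_in (A `&` M) r -> J r.[x].
  move=> mr; rewrite horner_coef; elim/big_ind: _ => // i _; rewrite mulrC.
  apply: JM; last exact/mJ/mr.
  by rewrite -hornerXn; apply/etale_local_horner/coefs_inXn.
have [|u [r [Au mr fE]]] := divg f Af.
  by rewrite (rootP fx); exact: valuation_ideal0.
have Mr p : coefs_in (A `&` M) p -> M p.[x].
  by move=> mp; apply: ideal_horner => // i; have [] := mp i.
(* If [u.[x]] were in [M], every term of the derivative of [g * u + r] at [x] would be in [M],
   against [dfx]. Then [f.[x] = 0] expresses [g.[x]] through [r.[x]]. *)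
have Mu : ~ M u.[x].
  move=> Mu; apply: dfx; rewrite fE derivD derivM !hornerD !hornerM.
  apply: valuation_idealD; first apply: valuation_idealD.
  - apply: valuation_idealMl => //; apply: coefs_in_horner => i.
    by apply/(subring_predE hA); rewrite coef_deriv rpredMn //; exact/subring_predE.
  - apply: valuation_idealMr => //; apply: coefs_in_horner => i.
    by apply/(subring_predE hA); rewrite coef_deriv rpredMn //; exact/subring_predE.
  - apply: Mr => i; rewrite coef_deriv -mulr_natl.
    have [_ _ _ mM] := (center_proper_ideal hA AO).1; apply: mM => //.
    by apply/(subring_predE hA); rewrite rpred_nat.
have Jg : J g.[x].
  have Bu : B u.[x]^-1 by apply: unitB => //; exact: etale_local_horner.
  have -> : g.[x] = - u.[x]^-1 * r.[x].
    have : g.[x] * u.[x] + r.[x] = 0 by rewrite -hornerM -hornerD -fE; exact/rootP.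
    move=> /eqP; rewrite addr_eq0 => /eqP /(canRL (mulfK (valuation_nideal_neq0 Mu))) ->.
    by rewrite mulrC mulrN mulNr.
  by apply: JM; [exact: subringN|exact: Jm].
move=> _ [[h [k [Ah Ak Mk ->]]] /(etale_local_center Ah Ak Mk) /(divg _ Ah)].
move=> [q [p [Aq mp ->]]]; rewrite mulrC; apply: (JM).
  by apply: unitB => //; exact: etale_local_horner.
rewrite hornerD hornerM mulrC; apply: JD; last exact: Jm.
by apply: JM => //; exact: etale_local_horner.
Qed.

End EtaleAscent.

(** * Incomparability, primes avoiding a multiplicative set, and ascent of regularity *)

Section PrimeIdeals.
Variables (F : fieldType) (A B : set F).
Hypotheses (hA : subring A) (hB : subring B) (AB : A `<=` B).
Implicit Types (I P Q : set F).

Lemma prime_contraction Q : Defs.prime_ideal B Q -> Defs.prime_ideal A (Q `&` A).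
Proof.
move=> [[[QB Q0 QD QM] Q1] Qpr]; split; first split.
- split=> [y []//||y z [Qy Ay] [Qz Az]|a y Aa [Qy Ay]].
  + by split=> //; exact: subring0.
  + by split; [exact: QD|exact: subringD].
  + by split; [apply: QM => //; exact: AB|exact: subringM].
- by case=> /Q1.
- by move=> y z Ay Az [Qyz _]; have [] := Qpr y z (AB Ay) (AB Az) Qyz; [left|right].
Qed.

(** For [y] in [Q'] outside [Q], go through Horner's scheme of its monic equation: if [p_k + d y] is
    in [Q], then [p_k] is in [Q'] and in [A], hence in [Q], and so is [d]. The last step puts the
    leading coefficient 1 in [Q]. *)
Lemma prime_incomparable Q Q' : Defs.prime_ideal B Q -> Defs.prime_ideal B Q' -> Q `<=` Q' ->
  Q' `&` A `<=` Q -> forall y, integral_over A y -> B y -> Q' y -> Q y.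
Proof.
move=> [[[QB Q0 QD QM] Q1] Qpr] [[[Q'B Q'0 Q'D Q'M] Q'1] Q'pr] QQ' Q'AQ.
move=> y [p [/(polyOver_setP _ (subring0 hA)) Ap mon_p py]] By Q'y; apply: contrapT => nQy.
have step k : Q (drop_poly k p).[y].
  elim: k => [|k IHk]; first by rewrite drop_poly0l (rootP py).
  have Bd : B (drop_poly k.+1 p).[y].
    apply/(subring_predE hB); apply: rpred_horner; last exact/subring_predE.
    by apply/(@polyOver_setP F B _ (subring0 hB)) => i; rewrite coef_drop_poly; exact: AB.
  move: IHk; rewrite horner_drop_poly => Qsum.
  have Qpk : Q p`_k.
    apply: Q'AQ; split=> //; rewrite -[p`_k](addrK ((drop_poly k.+1 p).[y] * y)).
    rewrite -mulN1r mulrA; apply: Q'D; first exact: QQ'.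
    apply: Q'M => //; apply: (subringM hB) => //; apply: subringN => //; exact: subring1.
  have : Q ((drop_poly k.+1 p).[y] * y).
    rewrite -[X in Q X](addKr p`_k) -mulN1r; apply: QD => //; apply: QM => //.
    by apply: subringN => //; exact: subring1.
  by move=> /(Qpr _ _ Bd By) [].
apply: Q1; have := step (size p).-1.
have p_gt0 : (0 < size p)%N by rewrite size_poly_gt0 monic_neq0.
rewrite horner_drop_poly drop_poly_eq0 ?prednK // horner0 mul0r addr0.
by rewrite -lead_coefE (monicP mon_p).
Qed.

End PrimeIdeals.

Section PrimeAvoiding.
Variables (F : fieldType) (B : set F).
Hypothesis hB : subring B.

(** An ideal maximal among those avoiding [T] is prime: if [y] and [z] are outside it, both enlarged
    ideals meet [T], and when [y * z] is inside it, so is the product of the two elements of [T]. *)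
Lemma ideal_maximal_avoiding (T I0 : set F) : T 1 ->
  (forall s t, T s -> T t -> T (s * t)) -> ideal B I0 -> I0 `&` T = set0 ->
  exists Q, [/\ Defs.prime_ideal B Q, I0 `<=` Q & Q `&` T = set0].
Proof.
move=> T1 TM idI0 I0T.
pose P I := I = set0 \/ [/\ ideal B I, I0 `<=` I & I `&` T = set0].
have [G GP Gtot|Q [PQ maxQ]] := @Zorn_bigcup _ P.
  have [Ge|/existsNP [X /not_implyP [GX X0]]] := pselect (forall X, G X -> X = set0).
    by left; apply/seteqP; split=> // q [X /Ge ->].
  have [//|[[XB X_0 XD XM] I0X XT]] := GP _ GX.
  have good W q : G W -> W q -> ideal B W by move=> /GP [-> //|[]].
  right; split.
  - split=> [q [W GW Wq]||q r [W GW Wq] [Z GZ Zr]|a q Ba [W GW Wq]].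
    + by have [WB _ _ _] := good _ _ GW Wq; exact: WB.
    + by exists X.
    + have [WZ|ZW] := Gtot _ _ GW GZ.
        by exists Z => //; have [_ _ ZD _] := good _ _ GZ Zr; apply: ZD => //; exact: WZ.
      by exists W => //; have [_ _ WD _] := good _ _ GW Wq; apply: WD => //; exact: ZW.
    + by exists W => //; have [_ _ _ WM] := good _ _ GW Wq; exact: WM.
  - by move=> q /I0X Xq; exists X.
  - apply/seteqP; split=> // q [[W GW Wq] Tq].
    have [W0|[_ _ WT]] := GP _ GW; first by rewrite W0 in Wq.
    by rewrite -WT.
have [idQ I0Q QT] : [/\ ideal B Q, I0 `<=` Q & Q `&` T = set0].
  case: PQ => [Q0|//]; exfalso; apply: (maxQ I0); last by right; split.
  rewrite Q0; split=> // sub; have [_ I00 _ _] := idI0; exact: (sub _ I00).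
have [QB Q_0 QD QM] := idQ.
have notT q : Q q -> ~ T q by move=> Qq Tq; have : (Q `&` T) q by []; rewrite QT.
have meets y : B y -> ~ Q y -> exists q b, [/\ Q q, B b & T (q + b * y)].
  move=> By nQy; apply: contrapT => nT.
  pose J := [set z | exists q b, [/\ Q q, B b & z = q + b * y]].
  have QJ : Q `<=` J.
    by move=> q Qq; exists q, 0; rewrite mul0r addr0; split=> //; exact: subring0.
  apply: (maxQ J).
    split=> // JQ; apply: nQy; apply: JQ; exists 0, 1.
    by rewrite mul1r add0r; split=> //; exact: subring1.
  right; split; last 2 first.
  - by move=> z /I0Q /QJ.
  - apply/seteqP; split=> // z [[q [b [Qq Bb ->]]] Tz].
    by apply: nT; exists q, b.
  split.
  - move=> _ [q [b [Qq Bb ->]]]; apply: (subringD hB); first exact: QB.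
    exact: (subringM hB).
  - exact: QJ.
  - move=> _ _ [q [b [Qq Bb ->]]] [r [c [Qr Bc ->]]].
    exists (q + r), (b + c); rewrite mulrDl addrACA; split=> //; first exact: QD.
    exact: (subringD hB).
  - move=> a _ Ba [q [b [Qq Bb ->]]]; exists (a * q), (a * b).
    by rewrite mulrDr mulrA; split=> //; [exact: QM|exact: (subringM hB)].
exists Q; split=> //; split; first by split=> // Q1; exact: (notT _ Q1).
move=> y z By Bz Qyz; apply: contrapT => /not_orP [nQy nQz].
have [q [b [Qq Bb Tqb]]] := meets _ By nQy.
have [r [c [Qr Bc Trc]]] := meets _ Bz nQz.
apply: (notT _ _ (TM _ _ Tqb Trc)).
rewrite mulrDl; apply: (QD).
  rewrite mulrC; apply: (QM) => //; apply: (subringD hB); first exact: QB.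
  exact: (subringM hB).
rewrite mulrDr; apply: (QD); first by apply: (QM) => //; exact: (subringM hB).
by rewrite mulrACA; apply: (QM) => //; exact: (subringM hB).
Qed.

End PrimeAvoiding.

Section EtaleRegular.
Variables (F : fieldType) (v : valuation F) (A : set F) (x : F) (f : {poly F}).
Local Notation O := (valuation_ring v).
Local Notation M := (valuation_ideal v).
Hypotheses (hA : subring A) (AO : A `<=` O) (unitA : forall a, A a -> ~ M a -> A a^-1).
Hypotheses (Ox : O x) (mon_f : f \is monic) (Af : forall i, A f`_i) (fx : root f x).
Hypothesis dfx : ~ M f^`().[x].
Hypothesis indep : forall h : {poly F},
  (forall i, A h`_i) -> h != 0 -> root h x -> (size f <= size h)%N.

Local Notation B := (etale_local v A x).
Let hB : subring B := etale_local_subring hA AO Ox.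
Let BO : B `<=` O := etale_local_valued AO Ox.
Let unitB := etale_local_unit (x := x) AO Ox.
Let AB : A `<=` B := sub_etale_local v x hA.
Let Bhorner g : coefs_in A g -> B g.[x] := @etale_local_horner _ v A x hA g.

Lemma etale_local_integral g : coefs_in A g -> integral_over A g.[x].
Proof.
move=> Ag; have hC := integral_over_subring hA.
apply/(subring_predE hC); apply: rpred_horner.
  by apply/(@polyOver_setP F _ _ (subring0 hC)) => i; exact: integral_over_id.
apply/subring_predE; exists f; split=> //.
exact/(polyOver_setP _ (subring0 hA)).
Qed.

(** As in Hilbert's basis theorem, the top coefficients form an ideal of [A]; polynomials realizing
    its generators are added to those obtained for smaller degree. *)
Lemma polynomial_module_fg k N : noetherian A -> submodule A N ->
  exists2 s : seq F, [set` s] `<=` N & forall J, submodule A J -> [set` s] `<=` J ->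
    forall g, coefs_in A g -> (size g <= k)%N -> N g.[x] -> J g.[x].
Proof.
move=> noeA hN; have [N0 ND NM] := hN; elim: k => [|k [s sN sP]].
  exists [::] => // J [J0 _ _] _ g _.
  by rewrite leqn0 size_poly_eq0 => /eqP ->; rewrite horner0.
have lead_ideal (J : set F) : submodule A J -> ideal A [set a | A a /\ exists g,
    [/\ coefs_in A g, (size g <= k.+1)%N, g`_k = a & J g.[x]]].
  move=> [J0 JD JM]; split=> [a []//||a b|a b Aa].
  - split; first exact: subring0.
    by exists 0; rewrite size_poly0 coef0 horner0; split=> // i; rewrite coef0; exact: subring0.
  - move=> [Aa [g [Ag sg <- Jg]]] [Ab [h [Ah sh <- Jh]]]; split; first exact: subringD.
    exists (g + h); rewrite coefD hornerD; split=> //; [exact: coefs_inD| |exact: JD].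
    by rewrite (leq_trans (size_polyD _ _)) // geq_max sg.
  - move=> [Ab [g [Ag sg <- Jg]]]; split; first exact: subringM.
    exists (a *: g); rewrite coefZ hornerZ; split=> //; last exact: JM.
      by move=> i; rewrite coefZ; exact: subringM.
    exact: leq_trans (size_scale_leq _ _) sg.
have [t tE] := noeA _ (lead_ideal N hN).
have tP a : a \in t -> A a /\ exists g, [/\ coefs_in A g, (size g <= k.+1)%N, g`_k = a & N g.[x]].
  move=> at_; have : ideal_gen A t a by exact: gen_ideal_gen.
  by rewrite -tE.
have /choice [G GP] : forall a, exists g, a \in t ->
    [/\ coefs_in A g, (size g <= k.+1)%N, g`_k = a & N g.[x]].
  move=> a; have [/tP [_ [g gP]]|na] := boolP (a \in t); first by exists g.
  by exists 0.
exists ([seq (G a).[x] | a <- t] ++ s).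
  by move=> y /=; rewrite mem_cat => /orP [/mapP [a /GP [_ _ _ Na] ->]|/sN].
move=> J hJ sJ g Ag sg Ng; have [J0 JD JM] := hJ.
have hNJ : submodule A (N `&` J).
  split=> [|y z [Ny Jy] [Nz Jz]|a y Aa [Ny Jy]]; first by split.
    by split; [exact: ND|exact: JD].
  by split; [exact: NM|exact: JM].
(* The generators [t] are top coefficients of values in both [N] and [J], so some [h] with value in
   both has the same top coefficient as [g], and [g - h] is smaller. *)
have [||_ [h [Ah sh hk [Nh Jh]]]] := ideal_gen_mem (lead_ideal _ hNJ) (s := t) _ (t := g`_k).
- move=> a /= at_; have [Aa _] := tP _ at_; have [AG sG Gk NG] := GP _ at_.
  split=> //; exists (G a); split=> //; split=> //; apply: sJ.
  by rewrite /= mem_cat; apply/orP; left; apply/mapP; exists a.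
- by rewrite -tE; split=> //; exists g.
rewrite -(subrK h g) hornerD; apply: (JD) => //; apply: sP => //.
- by move=> y ys; apply: sJ; rewrite /= mem_cat orbC ys.
- exact: coefs_inB.
- apply/leq_sizeP => j; rewrite leq_eqVlt coefB => /predU1P [<-|kj]; first by rewrite hk subrr.
  by rewrite !nth_default ?subrr // (leq_trans _ kj).
- by rewrite hornerD hornerN; exact: (submoduleB hA hN).
Qed.

(** Up to a unit of [B], an element of an ideal is the value of a polynomial of degree below that of
    [f], and such values in the ideal are finitely generated over [A]. *)
Lemma etale_local_noetherian : noetherian A -> noetherian B.
Proof.
move=> noeA I [IB I0 ID IM].
have hI : submodule A I by split=> // a y Aa; apply: IM; exact: AB.
have [s sI sP] := polynomial_module_fg (size f) noeA hI.
exists s; apply/seteqP; split; last exact: ideal_gen_mem.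
move=> i Ii J [[JB J0 JD JM] sJ]; have [g [h [Ag Ah Mh iE]]] := IB _ Ii.
have h0 := valuation_nideal_neq0 Mh.
have [g' [Ag' sg' g'x]] := coefs_reduce hA mon_f Af fx (submodule_self hA) Ag.
rewrite iE mulrC; apply: (JM); first by apply: unitB => //; exact: Bhorner.
rewrite -g'x; apply: sP => //; last 2 first.
- exact: ltnW.
- have -> : g'.[x] = h.[x] * i by rewrite iE mulrC divfK.
  by apply: IM => //; exact: Bhorner.
by split=> // a y Aa; apply: JM; exact: AB.
Qed.

Lemma ideal_coefs_horner (P J : set F) p : ideal B J -> P `<=` J -> coefs_in P p -> J p.[x].
Proof.
move=> [JB J0 JD JM] PJ Pp; rewrite horner_coef; elim/big_ind: _ => // i _.
rewrite mulrC; apply: JM; last exact/PJ/Pp.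
by rewrite -hornerXn; apply: Bhorner; exact: coefs_inXn.
Qed.

(* [A[x]] is free over [A] with basis the powers of [x] below the degree of [f], so
   [a s \in P A[x]] with [a] outside the prime [P] implies [s \in P A[x]]. *)
Lemma etale_local_going_down P Q' : Defs.prime_ideal A P -> Defs.prime_ideal B Q' ->
  P `<=` Q' -> exists Q, [/\ Defs.prime_ideal B Q, Q `<=` Q' & Q `&` A = P].
Proof.
move=> [[idP P1] Ppr] [[idQ' Q'1] Q'pr] PQ'.
have [PA P0 PD PM] := idP; have [Q'B Q'0 Q'D Q'M] := idQ'.
have subP : submodule A P by split.
have PcoefM p h : coefs_in P p -> coefs_in A h -> coefs_in P (p * h).
  move=> Pp Ah i; rewrite coefM; elim/big_ind: _ => // j _; rewrite mulrC.
  by apply: PM; [exact: Ah|exact: Pp].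
(* The ideal [P B], with numerators in [P A[x]]. *)
pose PB := [set y | exists h k, [/\ coefs_in P h, coefs_in A k, ~ M k.[x] & y = h.[x] / k.[x]]].
have idPB : ideal B PB.
  split.
  - move=> _ [h [k [Ph Ak Mk ->]]]; exists h, k; split=> // i; exact/PA/Ph.
  - exists 0, 1%:P; rewrite horner0 mul0r hornerC; split=> //.
    + by move=> i; rewrite coef0.
    + by apply: coefs_inC => //; exact: subring1.
    + exact: valuation_ideal1.
  - move=> _ _ [h [k [Ph Ak Mk ->]]] [h' [k' [Ph' Ak' Mk' ->]]].
    have [Akk' Mkk'] := etale_local_unit_poly hA AO Ox Ak Ak' Mk Mk'.
    exists (h * k' + h' * k), (k * k'); split=> //.
      by move=> i; rewrite coefD; apply: PD; exact: PcoefM.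
    rewrite !(hornerD, hornerM) addf_div //; exact: (@valuation_nideal_neq0 _ v).
  - move=> _ _ [g [k [Ag Ak Mk ->]]] [h' [k' [Ph' Ak' Mk' ->]]].
    have [Akk' Mkk'] := etale_local_unit_poly hA AO Ox Ak Ak' Mk Mk'.
    exists (h' * g), (k * k'); split=> //; first exact: PcoefM.
    by rewrite !hornerM mulf_div [g.[x] * _]mulrC.
(* A prime avoiding [T] lies below [Q'] (take [a = 1]) and contracts into [P] (take [s = 1]);
   containing [PB], it contracts exactly to [P]. *)
pose T := [set y | exists a s, [/\ A a, ~ P a, B s, ~ Q' s & y = a * s]].
have T1 a s : A a -> ~ P a -> B s -> ~ Q' s -> T (a * s) by move=> *; exists a, s.
have A1 := subring1 hA; have B1 := subring1 hB.
have [||||Q [pQ PBQ QT]] := @ideal_maximal_avoiding _ B hB T PB.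
- by rewrite -(mul1r 1); exact: T1.
- move=> _ _ [a [s [Aa Pa Bs Qs ->]]] [a' [s' [Aa' Pa' Bs' Qs' ->]]].
  rewrite mulrACA; apply: T1; [exact: subringM| |exact: (subringM hB)|].
    by move=> /(Ppr _ _ Aa Aa') [].
  by move=> /(Q'pr _ _ Bs Bs') [].
- exact: idPB.
- apply/seteqP; split=> // y [[h [k [Ph Ak Mk e]]] [a [s [Aa Pa Bs Qs ye]]]].
  have [g [l [Ag Al Ml sE]]] := Bs.
  have k0 := valuation_nideal_neq0 Mk; have l0 := valuation_nideal_neq0 Ml.
  have [u [Au su ux]] := coefs_reduce hA mon_f Af fx (submodule_self hA) (coefs_inM hA Ag Ak).
  have [r [Pr sr rx]] := coefs_reduce hA mon_f Af fx subP (PcoefM _ _ Ph Al).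
  (* The difference vanishes at [x] and is smaller than [f], so [indep] makes it zero; the
     comparison of coefficients follows. *)
  have aur : a *: u = r.
    apply/eqP; rewrite -subr_eq0; apply: contraT => n0.
    have : (size f <= size (a *: u - r)%R)%N.
      apply: indep => // [i|].
        by rewrite coefB coefZ; apply: subringB => //; [exact: subringM|exact/PA/Pr].
      rewrite rootE hornerD hornerN hornerZ ux rx !hornerM subr_eq0; apply/eqP.
      by move/eqP: ye; rewrite e sE mulrA eqr_div // mulrA => /eqP.
    rewrite leqNgt (leq_ltn_trans (size_polyD _ _)) // gtn_max size_polyN sr andbT.
    exact: leq_ltn_trans (size_scale_leq _ _) su.
  have Pu : coefs_in P u.
    move=> i; have := Pr i; rewrite -aur coefZ => /(Ppr _ _ Aa (Au i)) [] //.
  apply: Qs; rewrite sE; have -> : g.[x] / l.[x] = (k.[x]^-1 / l.[x]) * u.[x].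
    rewrite ux hornerM mulrC [g.[x] * _]mulrC mulrA.
    by rewrite [_ / _ * k.[x]]mulrAC mulVf // mul1r.
  apply: Q'M; last exact: ideal_coefs_horner Pu.
  by apply: (subringM hB); apply: unitB => //; exact: Bhorner.
have [[[QB Q_0 _ _] _] _] := pQ.
have notT q : Q q -> ~ T q by move=> Qq Tq; have : (Q `&` T) q by []; rewrite QT.
exists Q; split=> //.
- move=> q Qq; apply: contrapT => nQ'; apply: (notT _ Qq).
  by rewrite -(mul1r q); apply: T1 => //; exact: QB.
- apply/seteqP; split=> [a [Qa Aa]|a Pa].
    apply: contrapT => nPa; apply: (notT _ Qa).
    by rewrite -(mulr1 a); exact: T1.
  split; last exact: PA.
  apply: PBQ; exists a%:P, 1%:P; rewrite !hornerC divr1; split=> //.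
  + by move=> i; rewrite coefC; case: eqP.
  + exact: coefs_inC.
  + exact: valuation_ideal1.
Qed.

(** Going-down works from the top, so the induction first lifts the largest prime and then the rest
    of the chain below it. *)
Lemma etale_local_chain n P Q' : prime_chain A n P -> Defs.prime_ideal B Q' -> P n `<=` Q' ->
  exists Q, [/\ prime_chain B n Q, Q n `<=` Q' &
    forall i, (i <= n)%N -> Q i `&` A = P i].
Proof.
elim: n Q' => [|n IHn] Q' [Ppr Plt] pQ' PQ'.
  have [Q [pQ QQ' QA]] := etale_local_going_down (Ppr 0%N isT) pQ' PQ'.
  by exists (fun=> Q); split=> // i; rewrite leqn0 => /eqP ->.
have [Q1 [pQ1 Q1Q' Q1A]] := etale_local_going_down (Ppr n.+1 (leqnn _)) pQ' PQ'.
have [||Q [[Qpr Qlt] QQ1 QA]] := IHn Q1 _ pQ1.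
- split=> i hi; first by apply: Ppr; exact: leqW.
  by apply: Plt; exact: leqW.
- move=> a /(Plt n (leqnn _)).1; rewrite -Q1A => -[] //.
pose R i := if (i <= n)%N then Q i else Q1.
have RA i : (i <= n.+1)%N -> R i `&` A = P i.
  rewrite /R leq_eqVlt ltnS => /predU1P [->|hi]; first by rewrite ltnn.
  by rewrite hi QA.
exists R; split=> //.
- split=> i hi; first by rewrite /R; case: ifP => // ?; exact: Qpr.
  split; last first.
    move=> sub; apply: (Plt i hi).2; rewrite -RA // -RA ?(ltnW hi) //.
    by move=> a [/sub Ra Aa].
  rewrite /R; case: (ltnP i n) => [lt_in|]; first by rewrite (ltnW lt_in); exact: (Qlt i lt_in).1.
  move=> ni; have -> : i = n by apply/eqP; rewrite eqn_leq ni andbT -ltnS.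
  by rewrite leqnn.
- by rewrite /R ltnn.
Qed.

(** Going-down lifts a chain of [A] to one below [B ∩ M], and by incomparability a chain of [B]
    stays strict when contracted to [A]. *)
Lemma etale_local_krull_dim d : has_krull_dim A d -> has_krull_dim B d.
Proof.
move=> [[P [Ppr Plt]] dimA]; split.
  have [|||Q [Qchain _ _]] := @etale_local_chain d P (B `&` M).
  - by split.
  - exact: center_prime_ideal.
  - move=> a Pa; have [pP _] := Ppr d (leqnn _).
    by have [/AB Ba Ma] := proper_ideal_center unitA pP Pa.
  by exists Q.
move=> n Q [Qpr Qlt]; apply: (dimA n (fun i => Q i `&` A)); split=> i hi.
  exact: prime_contraction (Qpr _ hi).
have [QQ nQQ] := Qlt i hi; split; first by move=> a [/QQ Qa Aa].
move=> sub; apply: nQQ => b Q'b.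
have [[[Q'B _ _ Q'M] _] _] := Qpr _ hi; have [[[_ _ _ QM] _] _] := Qpr _ (ltnW hi).
have [g [h [Ag Ah Mh bE]]] := Q'B _ Q'b; have h0 := valuation_nideal_neq0 Mh.
(* Elements of [B] need not be integral over [A], but the numerator [g.[x]] is, and it differs from
   [b] by a unit. *)
rewrite bE mulrC; apply: QM; first by apply: unitB => //; exact: Bhorner.
apply: (prime_incomparable hA hB AB (Qpr _ (ltnW hi)) (Qpr _ hi)) => //.
- by move=> a /sub [].
- exact: etale_local_integral.
- exact: Bhorner.
- have -> : g.[x] = h.[x] * b by rewrite bE mulrC divfK.
  by apply: Q'M => //; exact: Bhorner.
Qed.

Lemma etale_local_regular : regular_local_ring A -> regular_local_ring B.
Proof.
move=> [_ noeA [m [locm [d [dimd [s sd mE]]]]]]; split=> //.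
  exact: etale_local_noetherian.
have {locm} mAM : A `&` M = m.
  by apply/locm/(local_ring_center hA AO unitA).
exists (B `&` M); split; first exact: local_ring_center.
exists d; split; first exact: etale_local_krull_dim.
exists s => //; have sAM : [set` s] `<=` A `&` M.
  by move=> y ys; rewrite mAM mE; exact: gen_ideal_gen.
have sB : [set` s] `<=` B by move=> y /sAM [/AB].
have idBs := ideal_gen_ideal hB sB.
apply/seteqP; split; last first.
  apply: ideal_gen_mem; first by case: (center_proper_ideal hB BO).
  by move=> y ys; have [/AB] := sAM _ ys.
apply: (etale_local_maximal hA AO unitA Ox mon_f Af fx dfx idBs).
rewrite mAM mE => y ys J [[JB J0 JD JM] sJ].
suff : (J `&` A) y by case.
apply: ys; split; last by move=> z zs; split; [exact: sJ|have [] := sAM _ zs].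
split=> [z []//||z t [Jz Az] [Jt At]|a z Aa [Jz Az]].
- by split=> //; exact: subring0.
- by split; [exact: JD|exact: subringD].
- by split; [apply: JM => //; exact: AB|exact: subringM].
Qed.

End EtaleRegular.

(** * Local uniformization *)

Section Localizations.
Variables (F : fieldType) (v : valuation F) (R : set F).
Hypotheses (hR : subring R) (RO : R `<=` valuation_ring v).
Local Notation M := (valuation_ideal v).
Local Notation D := (localization R (center v R)).

Let hO := valuation_subring v.

Lemma localization_centerP y :
  D y <-> exists a b, [/\ R a, R b, ~ M b & y = a / b].
Proof.
by split=> -[a [b [Ra Rb Mb ->]]]; exists a, b; split=> // Mb'; apply: Mb;
  [split|case: Mb'].
Qed.

Lemma sub_localization_center : R `<=` D.
Proof.
move=> a Ra; apply/localization_centerP; exists a, 1; rewrite divr1; split=> //.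
  exact: subring1.
exact: valuation_ideal1.
Qed.

Lemma localization_center_valued : D `<=` valuation_ring v.
Proof.
move=> _ /localization_centerP [a [b [Ra Rb Mb ->]]].
by apply: (subringM hO); [exact: RO|apply: valuation_unit => //; exact: RO].
Qed.

Lemma localization_center_unit y : D y -> ~ M y -> D y^-1.
Proof.
move=> /localization_centerP [a [b [Ra Rb Mb ->]]] Mab; apply/localization_centerP.
exists b, a; rewrite invf_div; split=> // Ma; apply: Mab.
by apply: valuation_idealMr => //; apply: valuation_unit => //; exact: RO.
Qed.

Lemma localization_center_subring : subring D.
Proof.
apply/subringP; split; first by apply: sub_localization_center; exact: subring1.
- move=> _ _ /localization_centerP [a [b [Ra Rb Mb ->]]]
    /localization_centerP [c [d [Rc Rd Md ->]]]; apply/localization_centerP.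
  exists (a * d - c * b), (b * d); split.
  + by apply: subringB => //; exact: subringM.
  + exact: subringM.
  + by move=> /(valuation_prime (RO Rb) (RO Rd)) [].
  + rewrite -mulNr addf_div ?mulNr //; exact: (@valuation_nideal_neq0 _ v).
- move=> _ _ /localization_centerP [a [b [Ra Rb Mb ->]]]
    /localization_centerP [c [d [Rc Rd Md ->]]]; apply/localization_centerP.
  exists (a * c), (b * d); rewrite mulf_div; split=> //; try exact: subringM.
  by move=> /(valuation_prime (RO Rb) (RO Rd)) [].
Qed.

Lemma fraction_fieldP y : fraction_field R y <-> exists a b, [/\ R a, R b, b != 0 & y = a / b].
Proof.
by split=> -[a [b [Ra Rb /eqP b0 ->]]]; exists a, b; split=> //; exact/eqP.
Qed.

Lemma sub_fraction_field : R `<=` fraction_field R.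
Proof.
move=> a Ra; apply/fraction_fieldP; exists a, 1; rewrite divr1 oner_eq0; split=> //.
exact: subring1.
Qed.

Lemma fraction_field_subfield : subfield (fraction_field R).
Proof.
apply/subfieldP; split; first by apply: sub_fraction_field; exact: subring1.
- move=> _ _ /fraction_fieldP [a [b [Ra Rb b0 ->]]] /fraction_fieldP [c [d [Rc Rd d0 ->]]].
  apply/fraction_fieldP; exists (a * d - c * b), (b * d); rewrite mulf_neq0 //; split=> //.
  + by apply: subringB => //; exact: subringM.
  + exact: subringM.
  + by rewrite -mulNr addf_div ?mulNr.
- move=> _ _ /fraction_fieldP [a [b [Ra Rb b0 ->]]] /fraction_fieldP [c [d [Rc Rd d0 ->]]].
  have [->|c0] := eqVneq c 0.
    rewrite mul0r invr0 mulr0; apply: sub_fraction_field; exact: subring0.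
  apply/fraction_fieldP; exists (a * d), (b * c); rewrite mulf_neq0 //; split=> //.
  + exact: subringM.
  + exact: subringM.
  + by rewrite invf_div mulf_div.
Qed.

End Localizations.

Section AdjoinRing.
Variables (F : fieldType) (K : set F).

Lemma adjoin_ring_subring T : subring (adjoin_ring K T).
Proof.
apply/subringP; split=> [X [] /subringP [] //|x y Ax Ay X XP|x y Ax Ay X XP].
  by have /subringP [_ XB _] := XP.1; apply: XB; [exact: Ax|exact: Ay].
by have /subringP [_ _ XD] := XP.1; apply: XD; [exact: Ax|exact: Ay].
Qed.

Lemma sub_adjoin_ring T : K `<=` adjoin_ring K T.
Proof. by apply: sub_smallest => x; left. Qed.

Lemma gen_adjoin_ring T : T `<=` adjoin_ring K T.
Proof. by apply: sub_smallest => x; right. Qed.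

Lemma adjoin_ring_sub T X : subring X -> K `<=` X -> T `<=` X -> adjoin_ring K T `<=` X.
Proof. by move=> hX KX TX; apply: smallest_sub => // x [/KX|/TX]. Qed.

End AdjoinRing.

(** The hypotheses on [x] and [f] are what [etale_presentation] provides inside the separable
    closure, brought back to [F]. *)
Lemma local_uniformization_etale (F : fieldType) (K L : set F) (v : valuation F)
    (x : F) (f : {poly F}) :
  trivial_on v K -> subfield L -> local_uniformization K L v ->
  valuation_ring v x -> f \is monic -> (forall i, (valuation_ring v `&` L) f`_i) ->
  root f x -> ~ valuation_ideal v f^`().[x] ->
  (forall h : {poly F}, (forall i, L h`_i) -> h != 0 -> root h x -> (size f <= size h)%N) ->
  (forall z, valuation_ring v z -> exists g h : {poly F},
    [/\ forall i, (valuation_ring v `&` L) g`_i, forall i, (valuation_ring v `&` L) h`_i,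
        ~ valuation_ideal v h.[x] & z = g.[x] / h.[x]]) ->
  local_uniformization K setT v.
Proof.
move=> trivK hL luL Ox mon_f OLf fx dfx indep gens Z /finite_seqP [t ->] ZO.
have hO := valuation_subring v; have rL := subfield_subring hL.
have /choice [G GP] : forall z, exists gh : {poly F} * {poly F}, z \in t ->
    [/\ forall i, (valuation_ring v `&` L) gh.1`_i,
        forall i, (valuation_ring v `&` L) gh.2`_i,
        ~ valuation_ideal v gh.2.[x] & z = gh.1.[x] / gh.2.[x]].
  move=> z; have [zt|nz] := boolP (z \in t); last by exists (0, 0).
  by have [g [h ghP]] := gens z (ZO _ zt).1; exists (g, h).
(* The coefficients of [f] and of the fractions presenting the elements of [Z]: once they are in
   [A], [Z] is contained in [B]. *)
pose W : seq F := (f : seq F) ++ flatten [seq ((G z).1 : seq F) ++ (G z).2 | z <- t].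
have [||R [[[r RE] RO fracR] regR WR]] := luL [set` W].
- exact: finite_seq.
- move=> a; rewrite /= mem_cat => /orP [/(nthP 0) [i _ <-]|/flatten_mapP [z zt]].
    exact: OLf.
  have [OG1 OG2 _ _] := GP z zt.
  by rewrite mem_cat => /orP [] /(nthP 0) [i _ <-]; [exact: OG1|exact: OG2].
have ROv : R `<=` valuation_ring v by move=> a /RO [].
have hR : subring R by rewrite RE; exact: adjoin_ring_subring.
set A := localization R (center v R) in regR WR.
have hA : subring A by exact: localization_center_subring.
have AO : A `<=` valuation_ring v by exact: localization_center_valued.
have unitA : forall a, A a -> ~ valuation_ideal v a -> A a^-1.
  by move=> a; exact: localization_center_unit.
have RA : R `<=` A by exact: sub_localization_center.
have AL : A `<=` L.
  move=> _ /localization_centerP [a [b [Ra Rb _ ->]]]; apply: (subringM rL).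
    by have [] := RO _ Ra.
  by apply: (subfieldV hL); have [] := RO _ Rb.
have coefsA (p : {poly F}) : {subset (p : seq F) <= W} -> coefs_in A p.
  move=> pW i; have [ip|pi] := ltnP i (size p); first exact/WR/pW/mem_nth.
  by rewrite nth_default //; exact: subring0.
have Af : coefs_in A f by apply: coefsA => a af; rewrite mem_cat af.
have indepA (h : {poly F}) : coefs_in A h -> h != 0 -> root h x -> (size f <= size h)%N.
  by move=> Ah; apply: indep => i; exact/AL/Ah.
have regB := etale_local_regular hA AO unitA Ox mon_f Af fx dfx indepA regR.
pose R1 := adjoin_ring K [set` x :: r].
have hR1 : subring R1 by exact: adjoin_ring_subring.
have R1x : R1 x by apply: gen_adjoin_ring; rewrite /= mem_head.
have RR1 : R `<=` R1.
  rewrite RE; apply: adjoin_ring_sub => //; first exact: sub_adjoin_ring.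
  by move=> a ar; apply: gen_adjoin_ring; rewrite /= inE ar orbT.
have R1O : R1 `<=` valuation_ring v.
  apply: adjoin_ring_sub => // a.
    move=> Ka; have [->|a0] := eqVneq a 0; first by left.
    by right; rewrite trivK.
  rewrite /= inE => /predU1P [->//|ar]; apply: ROv; rewrite RE.
  exact: gen_adjoin_ring.
have R1A : R1 `<=` [set g.[x] | g in coefs_in A].
  apply: adjoin_ring_sub.
  - apply/subringP; split.
    + exists 1%:P; rewrite ?hornerC //; apply: coefs_inC => //; exact: subring1.
    + move=> _ _ [g Ag <-] [h Ah <-]; exists (g - h); first exact: coefs_inB.
      by rewrite hornerD hornerN.
    + move=> _ _ [g Ag <-] [h Ah <-]; exists (g * h); first exact: coefs_inM.
      by rewrite hornerM.
  - move=> a Ka; exists a%:P; rewrite ?hornerC //; apply: coefs_inC => //.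
    by apply: RA; rewrite RE; exact: sub_adjoin_ring.
  - move=> a; rewrite /= inE => /predU1P [->|ar].
      by exists 'X^1; rewrite ?hornerXn //; exact: coefs_inXn.
    exists a%:P; rewrite ?hornerC //; apply: coefs_inC => //.
    by apply: RA; rewrite RE; exact: gen_adjoin_ring.
(* Denominators of elements of [A] lie in [R] outside [M], so they are already inverted in the
   localization of [R1]. *)
have locE : localization R1 (center v R1) = etale_local v A x.
  have hD := localization_center_subring hR1 R1O.
  apply/seteqP; split=> y.
    move=> /localization_centerP [a [b [/R1A [g Ag <-] /R1A [h Ah <-] Mh ->]]].
    by exists g, h.
  have AD : A `<=` localization R1 (center v R1).
    move=> _ /localization_centerP [a [b [Ra Rb Mb ->]]].
    by apply/localization_centerP; exists a, b; split=> //; exact: RR1.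
  have Dhorner (g : {poly F}) : coefs_in A g -> localization R1 (center v R1) g.[x].
    move=> Ag; apply/(subring_predE hD); apply: rpred_horner.
      by apply/(@polyOver_setP F _ _ (subring0 hD)) => i; exact/AD/Ag.
    by apply/subring_predE/sub_localization_center.
  move=> [g [h [Ag Ah Mh ->]]]; apply: (subringM hD); first exact: Dhorner.
  by apply: localization_center_unit => //; exact: Dhorner.
exists R1; rewrite locE; split=> //.
- split=> [|a R1a|]; first by exists (x :: r).
    by split=> //; exact: R1O.
  have hQ := fraction_field_subfield hR1; have rQ := subfield_subring hQ.
  have LQ : L `<=` fraction_field R1.
    rewrite -fracR => _ /fraction_fieldP [a [b [Ra Rb b0 ->]]].
    by apply/fraction_fieldP; exists a, b; split=> //; exact: RR1.
  have Qhorner (g : {poly F}) :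
      (forall i, (valuation_ring v `&` L) g`_i) -> fraction_field R1 g.[x].
    move=> Lg; apply/(subring_predE rQ); apply: rpred_horner.
      by apply/(@polyOver_setP F _ _ (subring0 rQ)) => i; apply: LQ; have [] := Lg i.
    by apply/subring_predE/sub_fraction_field.
  (* Each element of [F] or its inverse is in the valuation ring, so valued elements suffice to
     recover [F] as the fraction field. *)
  have OQ z : valuation_ring v z -> fraction_field R1 z.
    move=> /gens [g [h [Lg Lh Mh ->]]]; apply: (subringM rQ); first exact: Qhorner.
    by apply: (subfieldV hQ); exact: Qhorner.
  apply/seteqP; split=> // z _.
  have [/OQ //|/OQ] := valuation_total v z.
  by move=> /(subfieldV hQ); rewrite invrK.
- move=> z zt; have [_ _ MG zE] := GP z zt.
  exists (G z).1, (G z).2; split=> //; apply: coefsA => a aG;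
    rewrite mem_cat; apply/orP; right; apply/flatten_mapP; exists z => //;
    by rewrite mem_cat aG ?orbT.
Qed.

Section Pullback.
Variables (F S : fieldType) (iota : {rmorphism F -> S}) (v : valuation F) (w : valuation S).
Hypothesis ext : extends iota v w.

Lemma extends_ring a : valuation_ring w (iota a) <-> valuation_ring v a.
Proof. by rewrite -ext. Qed.

Lemma extends_ideal a : valuation_ideal w (iota a) <-> valuation_ideal v a.
Proof.
split=> /valuation_idealE [/extends_ring Oa h]; apply/valuation_idealE; split=> //.
  case: h => [/eqP|h]; first by rewrite fmorph_eq0 => /eqP; left.
  by right=> Oa'; apply: h; rewrite -fmorphV; exact/extends_ring.
case: h => [->|h]; first by left; rewrite rmorph0.
by right; rewrite -fmorphV => /extends_ring.
Qed.

Lemma extends_poly (L : set F) (p : {poly S}) : subfield L ->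
  p \is a polyOver [in valuation_ring w `&` iota @` L] ->
  exists q : {poly F}, map_poly iota q = p /\ forall i, (valuation_ring v `&` L) q`_i.
Proof.
move=> hL /allP pP; have rL := subfield_subring hL; have hO := valuation_subring v.
have /choice [c cP] : forall a, exists b, a \in (p : seq S) ->
    (valuation_ring v `&` L) b /\ iota b = a.
  move=> a; have [ap|nap] := boolP (a \in (p : seq S)); last by exists 0.
  have := pP _ ap; rewrite inE => -[Oa [b Lb ba]]; exists b => _.
  by rewrite -ba in Oa *; split=> //; split=> //; exact/extends_ring.
exists (\poly_(i < size p) c p`_i); split=> [|i].
  apply/polyP => i; rewrite coef_map coef_poly /=; case: ltnP => ip.
    by have [|] := cP p`_i => //; exact: mem_nth.
  by rewrite rmorph0 nth_default.
rewrite coef_poly; case: ltnP => ip; last by split; exact: subring0.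
by have [|] := cP p`_i => //; exact: mem_nth.
Qed.

End Pullback.

Theorem theorem1p9 (F : fieldType) (K : set F) (v : valuation F)
    (hK : subfield K) (hFK : function_field K) (hv : trivial_on v K)
    (hT : exists T : set F,
      [/\ transcendence_basis K T,
          local_uniformization K (adjoin_field K T) v
        & exists (Lsep : fieldType) (iota : {rmorphism F -> Lsep})
                 (w : valuation Lsep),
          [/\ separable_closure_of (iota @` adjoin_field K T),
              extends iota v w
            & range iota `<=`
                absolute_inertia_field (iota @` adjoin_field K T) w]]) :
  local_uniformization K setT v.
Proof.
have [T [_ luT [S [iota [w [hS ext inert]]]]]] := hT; have [s sE] := hFK.
set L := adjoin_field K T in luT hS inert.
have hL : subfield L by exact: adjoin_field_subfield.
have im_subfield (X : set F) : subfield X -> subfield (iota @` X).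
  move=> hX; have rX := subfield_subring hX.
  apply/subfieldP; split=> [|_ _ [a Xa <-] [b Xb <-]|_ _ [a Xa <-] [b Xb <-]].
  - by exists 1; rewrite ?rmorph1 //; exact: subring1.
  - by exists (a - b); rewrite ?rmorphB //; exact: subringB.
  - exists (a / b); rewrite ?fmorph_div //; apply: (subringM rX) => //.
    exact: subfieldV.
have hL' := im_subfield _ hL.
(* The image of [F] is generated over that of [L] by the finite tuple [s'], as the orbit arguments
   require. *)
pose s' := map iota s.
have K1E z : adjoin_field (iota @` L) [set` s'] (iota z).
  have hK1 : subfield (adjoin_field (iota @` L) [set` s']) by exact: adjoin_field_subfield.
  have rK1 := subfield_subring hK1.
  have : adjoin_field K [set` s] z by rewrite sE.
  apply: (@adjoin_field_sub _ _ _ (iota @^-1` adjoin_field (iota @` L) [set` s'])).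
  - apply/subfieldP; split=> [|a b|a b] /=.
    + by rewrite rmorph1; exact: (subring1 rK1).
    + by rewrite rmorphB; exact: (subringB rK1).
    + by rewrite fmorph_div => Ka Kb; apply: (subringM rK1) => //; exact: (subfieldV hK1).
  - move=> a Ka; apply: sub_adjoin_field; exists a => //; exact: sub_adjoin_field.
  - by move=> a /= as_; apply: gen_adjoin_field; exact: map_f.
have hF : subfield [set: F] by apply/subfieldP.
have K1_range : adjoin_field (iota @` L) [set` s'] `<=` range iota.
  apply: adjoin_field_sub; first exact: im_subfield.
    by move=> _ [a _ <-]; exists a.
  by move=> a /= /mapP [b _ ->]; exists b.
have K1_inert := subset_trans K1_range inert.
have [x' [f' [[Ox K1x] [mon_f Af] [fx dfx] fmin gens]]] := etale_presentation hL' hS K1_inert.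
have [x _ xE] := K1_range _ K1x.
have [f [fE OLf]] := extends_poly ext hL Af.
rewrite -xE -fE in Ox mon_f fx dfx fmin gens.
apply: (local_uniformization_etale hv hL luT (x := x) (f := f)) => //.
- exact/(extends_ring ext).
- by rewrite -(map_monic iota).
- by move: fx; rewrite rootE horner_map fmorph_eq0.
- by move=> /(extends_ideal ext); rewrite -horner_map -deriv_map.
- move=> h Lh h0 hx; rewrite -(size_map_poly iota) -(size_map_poly iota h); apply: fmin.
  + apply/(polyOver_setP _ (subring0 (subfield_subring hL'))) => i.
    by rewrite coef_map; exists h`_i.
  + by rewrite map_poly_eq0.
  + by rewrite rootE horner_map (rootP hx) rmorph0.
- move=> z Oz; have [||g' [h' [Ag Ah Mh zE]]] := gens (iota z).
  + exact/(extends_ring ext).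
  + exact: K1E.
  have [g [gE OLg]] := extends_poly ext hL Ag; have [h [hE OLh]] := extends_poly ext hL Ah.
  rewrite -gE -hE !horner_map in Mh zE.
  exists g, h; split=> //; first by move=> /(extends_ideal ext).
  by apply: (fmorph_inj iota); rewrite zE fmorph_div.
Qed.
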